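(* Let $\mathrm{D}^{Q}(\rho\|\sigma)$ be a quantity defined for pairs of density operators $\rho,\sigma$ on a common finite-dimensional Hilbert space. Suppose that the following conditions are satisfied. (M) (Monotonicity) For any CPTP map $\Lambda$, $\mathrm{D}^{Q}(\rho\|\sigma)\ge \mathrm{D}^{Q}(\Lambda(\rho)\|\Lambda(\sigma))$. (A) (Weak additivity) $\mathrm{D}^{Q}(\rho^{\otimes n}\|\sigma^{\otimes n})=n\,\mathrm{D}^{Q}(\rho\|\sigma)$. (C) (Lower asymptotic continuity) $$\lim_{n\to\infty}\|\tilde\rho^{n}-\rho^{\otimes n}\|_1=0\ \Longrightarrow\ \liminf_{n\to\infty}\frac1n\left\{\mathrm{D}^{Q}(\tilde\rho^{n}\|\sigma^{\otimes n})-\mathrm{D}^{Q}(\rho^{\otimes n}\|\sigma^{\otimes n})\right\}\ge 0 .$$ Then $$\mathrm{D}^{Q}(\rho\|\sigma)=\mathrm{const.}\times\mathrm{D}(\rho\|\sigma),\qquad \mathrm{D}(\rho\|\sigma):=\mathrm{tr}\,\rho(\ln\rho-\ln\sigma),$$ where the constant does not depend on $\rho,\sigma$.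
   Context: CPTP means completely positive and trace preserving; $\|\cdot\|_1$ is the trace norm. The conditions are required for all density operators $\rho,\sigma$, all integers $n\ge1$ in (A), and all sequences $\{\tilde\rho^{n}\}$ in (C), where $\tilde\rho^{n}$ is a density operator on $\mathcal{H}^{\otimes n}$ when $\rho,\sigma$ act on $\mathcal{H}$. *)

(* Defs.v *)
From HB Require Import structures.
From mathcomp Require Import all_boot all_order all_algebra spectral.
From mathcomp Require Import complex mxtens.
From mathcomp Require Import all_classical all_reals all_analysis.

Set Implicit Arguments.
Unset Strict Implicit.
Unset Printing Implicit Defensive.

Import Order.TTheory GRing.Theory Num.Theory.
Import numFieldNormedType.Exports.
Local Open Scope classical_set_scope.
Local Open Scope sesquilinear_scope.
Local Open Scope complex_scope.
Local Open Scope ring_scope.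

(* An operator on a d-dimensional Hilbert space is its matrix in a fixed
   orthonormal basis; the tensor product *t and the tensor powers ntensmx are
   those of mxtens. *)

Section Operators.
Variable R : realType.
Local Notation C := R[i].

Definition psdmx d (A : 'M[C]_d) : Prop :=
  A \is hermsymmx /\ forall v : 'rV[C]_d, 0 <= (v *m A *m v ^t*) 0 0.

Definition density d (rho : 'M[C]_d) : Prop := psdmx rho /\ \tr rho = 1.

(* Functional calculus: f is applied to the real parts of the eigenvalues, so
   this is the usual f(A) only for A Hermitian. *)
Definition mxfun (f : R -> R) d (A : 'M[C]_d) : 'M[C]_d :=
  invmx (spectralmx A)
  *m diag_mx (map_mx (fun z : C => (f (complex.Re z))%:C) (spectral_diag A))
  *m spectralmx A.

Definition trace_norm d (A : 'M[C]_d) : R :=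
  complex.Re (\tr (mxfun Num.sqrt (A ^t* *m A))).

Definition mxblk k d (X : 'M[C]_(k * d)) (i j : 'I_k) : 'M[C]_d :=
  \matrix_(a, b) X (mxtens_index (i, a)) (mxtens_index (j, b)).

(* id_k (x) L, for L acting on d x d matrices *)
Definition ampliation k d e (L : 'M[C]_d -> 'M[C]_e) (X : 'M[C]_(k * d)) :
    'M[C]_(k * e) :=
  \sum_(i < k) \sum_(j < k) delta_mx i j *t L (mxblk X i j).

Definition completely_positive d e (L : 'M[C]_d -> 'M[C]_e) : Prop :=
  forall k (X : 'M[C]_(k * d)), psdmx X -> psdmx (ampliation L X).

Definition cptp d e (L : {linear 'M[C]_d -> 'M[C]_e}) : Prop :=
  completely_positive L /\ forall X, \tr (L X) = \tr X.

(* For Hermitian matrices inclusion of row spaces is inclusion of supports. *)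
Definition supp_le d (rho sigma : 'M[C]_d) : bool := (rho <= sigma)%MS.

(* tr rho (ln rho - ln sigma), which is +oo when supp rho is not contained in
   supp sigma.  Since ln 0 = 0 in the library, mxfun ln is the logarithm on the
   support and 0 on the kernel, i.e. the convention 0 ln 0 = 0. *)
Definition relent d (rho sigma : 'M[C]_d) : \bar R :=
  if supp_le rho sigma
  then (complex.Re (\tr (rho *m (mxfun (@ln R) rho - mxfun (@ln R) sigma))))%:E
  else +oo%E.

Definition divergence := forall d, 'M[C]_d -> 'M[C]_d -> \bar R.

Definition cptp_monotone (DQ : divergence) : Prop :=
  forall d e (L : {linear 'M[C]_d -> 'M[C]_e}) (rho sigma : 'M[C]_d),
    cptp L -> density rho -> density sigma ->
    (DQ e (L rho) (L sigma) <= DQ d rho sigma)%E.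

Definition weakly_additive (DQ : divergence) : Prop :=
  forall d (rho sigma : 'M[C]_d) n, (0 < n)%N ->
    density rho -> density sigma ->
    DQ (d ^ n)%N (ntensmx rho n) (ntensmx sigma n) = (n%:R%:E * DQ d rho sigma)%E.

(* The dual subtraction has +oo - +oo = +oo: the condition constrains
   nothing where the difference is indeterminate.  (With +oo - +oo = -oo, the
   relative entropy itself would not be lower asymptotically continuous.) *)
Definition lower_asymptotically_continuous (DQ : divergence) : Prop :=
  forall d (rho sigma : 'M[C]_d) (trho : forall n, 'M[C]_(d ^ n)),
    density rho -> density sigma -> (forall n, density (trho n)) ->
    (fun n => trace_norm (trho n - ntensmx rho n)) @ \oo --> (0 : R) ->
    (0 <= limn_einf (fun n =>
       n%:R^-1%:E * (DQ (d ^ n)%N (trho n) (ntensmx sigma n)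
                     - DQ (d ^ n)%N (ntensmx rho n) (ntensmx sigma n))%dE))%E.

(* A divergence may be infinite only where the relative entropy is; without
   this, DQ = +oo off the diagonal and 0 on it would satisfy the conditions and
   be no real multiple of relent. *)
Definition finite_on_support (DQ : divergence) : Prop :=
  forall d (rho sigma : 'M[C]_d), density rho -> density sigma ->
    supp_le rho sigma -> DQ d rho sigma \is a fin_num.

(* y = c x, where the product 0 * +oo may be read either as 0 or as +oo.  Both
   readings are needed: DQ = 0, and DQ = 0 or +oo according to whether
   supp rho is contained in supp sigma, satisfy all the conditions. *)
Definition const_multiple (c : R) (x y : \bar R) : Prop :=
  y = (c%:E * x)%E \/ [/\ c = 0, x = +oo%E & y = +oo%E].

End Operators.

(* Main.v *)
Require Import Defs.
From HB Require Import structures.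
From mathcomp Require Import all_boot all_order all_algebra spectral.
From mathcomp Require Import complex mxtens.
From mathcomp Require Import all_classical all_reals all_analysis.
From mathcomp Require Import ring lra.

(* The classical pair (pi0, ref b) on C^2, with pi0 = |0><0| and
   ref b = e^-b |0><0| + (1 - e^-b) |1><1|, is a yardstick: by monotonicity and
   additivity its divergence is c b.  A pair (rho, sigma) with relative entropy
   D is compared with it asymptotically, in both directions, by
   measure-and-prepare channels that reproduce the second state exactly and the
   first one up to a vanishing error, which lower asymptotic continuity
   absorbs.
   Both directions only need the spectral projections P of rho^n and Q of
   sigma^n that the law of large numbers makes almost certain under rho^n.
   For a < D the test T = QPQ has tr sigma^n T <= e^-na and tr rho^n T -> 1;
   for a > D the smoothed state QP rho^n PQ is close to rho^n and bounded by
   e^na sigma^n.  The law of large numbers itself is a Chernoff bound, since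
   powers of sigma^n are tensor powers.
   If the support of rho is not contained in that of sigma, repeated testing
   for the kernel of sigma compares the pair with (|0><0|, |1><1|), whose
   divergence is 0 or +oo by additivity. *)

Set Implicit Arguments.
Unset Strict Implicit.
Unset Printing Implicit Defensive.

Import Order.TTheory GRing.Theory Num.Theory.
Import numFieldNormedType.Exports.
Local Open Scope classical_set_scope.
Local Open Scope sesquilinear_scope.
Local Open Scope complex_scope.
Local Open Scope ring_scope.

(** * Adjoints and tensor products *)

Section Adjoint.
Variable R : realType.
Local Notation C := R[i].

Lemma adjmxM m n p (A : 'M[C]_(m, n)) (B : 'M[C]_(n, p)) :
  (A *m B)^t* = B^t* *m A^t*.
Proof. by rewrite trmx_mul map_mxM. Qed.

Lemma adjmxD m n (A B : 'M[C]_(m, n)) : (A + B)^t* = A^t* + B^t*.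
Proof. by rewrite linearD /= map_mxD. Qed.

Lemma adjmxB m n (A B : 'M[C]_(m, n)) : (A - B)^t* = A^t* - B^t*.
Proof. by rewrite linearB /= map_mxB. Qed.

Lemma conjC_realc (a : R) : Num.conj (a%:C : C) = a%:C.
Proof. by rewrite conj_Creal //; apply/complex_realP; exists a. Qed.

Lemma adjmxZ m n (a : R) (A : 'M[C]_(m, n)) : (a%:C *: A)^t* = a%:C *: A^t*.
Proof.
apply/matrixP => i j; rewrite !mxE rmorphM; congr (_ * _). exact: conjC_realc.
Qed.

Lemma adjmx1 n : (1%:M : 'M[C]_n)^t* = 1%:M.
Proof. by rewrite trmx1 map_mx1. Qed.

Lemma adjmx_tens m n p q (A : 'M[C]_(m, n)) (B : 'M[C]_(p, q)) :
  (A *t B)^t* = A^t* *t B^t*.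
Proof. by rewrite trmx_tens map_mxT. Qed.

Lemma hermsymP n (A : 'M[C]_n) : (A \is hermsymmx) <-> A^t* = A.
Proof.
split=> [/is_hermitianmxP|] H; [|apply/is_hermitianmxP].
  by rewrite expr0 scale1r in H; rewrite -H.
by rewrite expr0 scale1r H.
Qed.

Lemma tensmx11 m n : (1%:M : 'M[C]_m) *t (1%:M : 'M[C]_n) = 1%:M.
Proof.
apply/matrixP => i j; case: (mxtens_indexP i) => a b.
case: (mxtens_indexP j) => c d; rewrite tensmxE !mxE.
rewrite (can_eq (@mxtens_indexK _ _)) xpair_eqE.
by case: (_ == _); case: (_ == _); rewrite ?mul1r ?mul0r.
Qed.

Lemma mxtrace_tens m n (A : 'M[C]_m) (B : 'M[C]_n) :
  \tr (A *t B) = \tr A * \tr B.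
Proof. by rewrite /mxtrace mulr_sum; apply: eq_bigr => i _; rewrite !mxE. Qed.

Lemma tensmxBl m n p q (A B : 'M[C]_(m, n)) (X : 'M[C]_(p, q)) :
  (A - B) *t X = A *t X - B *t X.
Proof. by apply/matrixP => i j; rewrite !mxE mulrBl. Qed.

Lemma tensmxBr m n p q (A B : 'M[C]_(m, n)) (X : 'M[C]_(p, q)) :
  X *t (A - B) = X *t A - X *t B.
Proof. by apply/matrixP => i j; rewrite !mxE mulrBr. Qed.

Lemma tensmxZl m n p q a (A : 'M[C]_(m, n)) (X : 'M[C]_(p, q)) :
  (a *: A) *t X = a *: (A *t X).
Proof. by apply/matrixP => i j; rewrite !mxE mulrA. Qed.

Lemma tensmxZr m n p q a (A : 'M[C]_(m, n)) (X : 'M[C]_(p, q)) :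
  X *t (a *: A) = a *: (X *t A).
Proof. by apply/matrixP => i j; rewrite !mxE mulrCA. Qed.

End Adjoint.

(** * Positive semidefinite matrices *)

Section Positive.
Variable R : realType.
Local Notation C := R[i].

Lemma psdmx_adj n (A : 'M[C]_n) : psdmx A -> A^t* = A.
Proof. by case=> /hermsymP. Qed.

Lemma row_gram_ge0 n (v : 'rV[C]_n) : 0 <= (v *m v^t*) 0 0.
Proof.
by rewrite mxE sumr_ge0 // => i _; rewrite !mxE mul_conjC_ge0.
Qed.

Lemma psdmx_gram m n (W : 'M[C]_(m, n)) : psdmx (W^t* *m W).
Proof.
split; first by apply/hermsymP; rewrite adjmxM trmxCK.
move=> v; rewrite !mulmxA -mulmxA -[W in X in _ *m X]trmxCK -adjmxM.
exact: row_gram_ge0.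
Qed.

Lemma psdmx_conj m n (A : 'M[C]_m) (W : 'M[C]_(m, n)) :
  psdmx A -> psdmx (W^t* *m A *m W).
Proof.
move=> [/hermsymP hA A0]; split.
  by apply/hermsymP; rewrite !adjmxM trmxCK hA mulmxA.
move=> v; have := A0 (v *m W^t*); rewrite adjmxM trmxCK.
by rewrite !mulmxA.
Qed.

Lemma psdmxD n (A B : 'M[C]_n) : psdmx A -> psdmx B -> psdmx (A + B).
Proof.
move=> [/hermsymP hA A0] [/hermsymP hB B0]; split.
  by apply/hermsymP; rewrite adjmxD hA hB.
by move=> v; rewrite mulmxDr mulmxDl mxE addr_ge0.
Qed.

Lemma psdmx0 n : psdmx (0 : 'M[C]_n).
Proof.
split; first by apply/hermsymP; rewrite trmx0 map_mx0.
by move=> v; rewrite mulmx0 mul0mx mxE.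
Qed.

Lemma psdmx1 n : psdmx (1%:M : 'M[C]_n).
Proof. by have := psdmx_gram (1%:M : 'M[C]_n); rewrite adjmx1 mulmx1. Qed.

Lemma psdmxZ n (a : R) (A : 'M[C]_n) : 0 <= a -> psdmx A -> psdmx (a%:C *: A).
Proof.
move=> a0 [/hermsymP hA A0]; split.
  by apply/hermsymP; rewrite adjmxZ hA.
by move=> v; rewrite -scalemxAr -scalemxAl mxE mulr_ge0 // ler0c.
Qed.

(** For unitary [V], the rows of [V] are left eigenvectors with real eigenvalues [x]. Any eigenbasis
    is allowed, so products within one basis and tensor products keep this form. *)
Definition hdiag n (V : 'M[C]_n) (x : 'I_n -> R) : 'M[C]_n :=
  V^t* *m diag_mx (\row_j (x j)%:C) *m V.

Lemma unitary_adjl n (V : 'M[C]_n) : V \is unitarymx -> V^t* *m V = 1%:M.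
Proof. by rewrite -trmxC_unitary => /unitarymxP; rewrite trmxCK. Qed.

Lemma hermitian_hdiag n (A : 'M[C]_n) : A^t* = A ->
  exists V x, V \is unitarymx /\ A = hdiag V x.
Proof.
move=> /hermsymP hA; have /orthomx_spectralP AE := hermitian_normalmx hA.
have Vu := spectral_unitarymx A.
exists (spectralmx A), (fun j => complex.Re (spectral_diag A 0 j)); split => //.
rewrite /hdiag -(invmx_unitary Vu) (_ : \row_j _ = spectral_diag A) //.
apply/rowP => j; rewrite mxE RRe_real //.
exact: (mxOverP (hermitian_spectral_diag_real hA)).
Qed.

Lemma hdiag_entry n (V : 'M[C]_n) x i : V \is unitarymx ->
  (row i V *m hdiag V x *m (row i V)^t*) 0 0 = (x i)%:C.
Proof.
move=> Vu; have VD : V *m hdiag V x *m V^t* = diag_mx (\row_j (x j)%:C).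
  by rewrite /hdiag !mulmxA (unitarymxP Vu) mul1mx -mulmxA (unitarymxP Vu) mulmx1.
rewrite rowE adjmxM (_ : _ *m _ = 'e_i *m (V *m hdiag V x *m V^t*) *m 'e_i^t*).
  2: by rewrite !mulmxA.
rewrite VD -mulmxA -rowE.
by rewrite mxE mul_diag_mx !mxE !eqxx rmorph1 mulr1.
Qed.

Lemma adj_hdiag n (V : 'M[C]_n) x : (hdiag V x)^t* = hdiag V x.
Proof.
rewrite /hdiag !adjmxM trmxCK mulmxA; congr (_ *m _ *m _).
rewrite tr_diag_mx map_diag_mx; congr diag_mx; apply/rowP => j; rewrite !mxE.
exact: conjC_realc.
Qed.

Lemma hdiag_psd n (V : 'M[C]_n) x : (forall i, 0 <= x i) -> psdmx (hdiag V x).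
Proof.
move=> x0; rewrite /hdiag; apply: psdmx_conj; split.
  apply/hermsymP; rewrite tr_diag_mx map_diag_mx; congr diag_mx.
  by apply/rowP => j; rewrite !mxE; exact: conjC_realc.
move=> v; rewrite mxE sumr_ge0 // => j _; rewrite mul_mx_diag !mxE mulrAC.
by rewrite mulr_ge0 ?mul_conjC_ge0 // ler0c.
Qed.

Lemma psd_hdiag n (A : 'M[C]_n) : psdmx A ->
  exists V x, [/\ V \is unitarymx, A = hdiag V x & forall i, 0 <= x i].
Proof.
move=> Ap; have [V [x [Vu AE]]] := hermitian_hdiag (psdmx_adj Ap).
exists V, x; split => // i; case: Ap => _ /(_ (row i V)).
by rewrite AE hdiag_entry // ler0c.
Qed.

Lemma mul_hdiag n (V : 'M[C]_n) x y : V \is unitarymx ->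
  hdiag V x *m hdiag V y = hdiag V (fun i => x i * y i).
Proof.
move=> Vu; rewrite /hdiag -!mulmxA [V *m (_ *m _)]mulmxA (unitarymxP Vu) mul1mx.
congr (_ *m _); rewrite mulmxA mulmx_diag; congr (diag_mx _ *m _).
by apply/rowP => j; rewrite !mxE rmorphM.
Qed.

Lemma hdiagB n (V : 'M[C]_n) x y :
  hdiag V x - hdiag V y = hdiag V (fun i => x i - y i).
Proof.
rewrite /hdiag -mulmxBl -mulmxBr -linearB /= (_ : _ - _ = \row_j (x j - y j)%:C) //.
by apply/rowP => j; rewrite !mxE rmorphB.
Qed.

Lemma hdiagZ n (V : 'M[C]_n) a x :
  a%:C *: hdiag V x = hdiag V (fun i => a * x i).
Proof.
rewrite /hdiag scalemxAl scalemxAr -linearZ /= (_ : _ *: _ = \row_j (a * x j)%:C) //.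
by apply/rowP => j; rewrite !mxE rmorphM.
Qed.

Lemma hdiag1 n (V : 'M[C]_n) : V \is unitarymx -> hdiag V (fun=> 1) = 1%:M.
Proof.
move=> Vu; rewrite /hdiag (_ : \row__ _ = const_mx 1).
  by rewrite diag_const_mx mulmx1 unitary_adjl.
by apply/rowP => j; rewrite !mxE.
Qed.

Lemma psdmx_root n (A : 'M[C]_n) : psdmx A -> exists W : 'M[C]_n, A = W^t* *m W.
Proof.
move=> /psd_hdiag [V [x [Vu -> x0]]]; exists (hdiag V (Num.sqrt \o x)).
rewrite adj_hdiag (mul_hdiag _ _ Vu) (_ : (fun i => _) = x) //.
by apply/funext => i /=; rewrite -expr2 sqr_sqrtr.
Qed.

Lemma mxtrace_psd_ge0 n (A : 'M[C]_n) : psdmx A -> 0 <= \tr A.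
Proof.
move=> /psdmx_root [W ->]; rewrite sumr_ge0 // => i _.
rewrite mxE sumr_ge0 // => j _; rewrite !mxE mulrC mul_conjC_ge0 //.
Qed.

Lemma mxtrace_psd_mul_ge0 n (A B : 'M[C]_n) : psdmx A -> psdmx B ->
  0 <= \tr (A *m B).
Proof.
move=> Ap /psdmx_root [W ->].
rewrite mulmxA mxtrace_mulC mulmxA; apply: mxtrace_psd_ge0.
by rewrite -[W in X in X *m _ *m _]trmxCK; exact: psdmx_conj.
Qed.

Lemma psdmx_tens m n (A : 'M[C]_m) (B : 'M[C]_n) : psdmx A -> psdmx B ->
  psdmx (A *t B).
Proof.
move=> /psdmx_root[W ->] /psdmx_root[Z ->].
by rewrite -tensmx_mul -adjmx_tens; exact: psdmx_gram.
Qed.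

Lemma unitarymx_tens m n (V : 'M[C]_m) (W : 'M[C]_n) :
  V \is unitarymx -> W \is unitarymx -> V *t W \is unitarymx.
Proof.
move=> /unitarymxP VV /unitarymxP WW; apply/unitarymxP.
by rewrite adjmx_tens tensmx_mul VV WW tensmx11.
Qed.

Lemma tens_hdiag m n (V : 'M[C]_m) (W : 'M[C]_n) x y :
  hdiag V x *t hdiag W y = hdiag (V *t W)
    (fun k => x (mxtens_unindex k).1 * y (mxtens_unindex k).2).
Proof.
have E : diag_mx (\row_j (x j)%:C) *t diag_mx (\row_j (y j)%:C) = diag_mx
    (\row_k (x (mxtens_unindex k).1 * y (mxtens_unindex k).2)%:C) :> 'M[C]_(m * n).
  apply/matrixP => i j; case: (mxtens_indexP i) => a b.
  case: (mxtens_indexP j) => c d; rewrite tensmxE !mxE !mxtens_indexK /=.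
  rewrite (can_eq (@mxtens_indexK _ _)) xpair_eqE rmorphM.
  by case: (_ == _); case: (_ == _); rewrite /= ?mulr0 ?mul0r.
by rewrite /hdiag adjmx_tens -E !tensmx_mul.
Qed.

(** Frees [mxfun] from the eigenbasis picked by [spectralmx]. The change of basis [W] intertwines
    the two diagonals, so an entry of [W] is nonzero only where the eigenvalues agree; hence [W]
    also intertwines their images under [f]. *)
Lemma mxfun_hdiag f n (V : 'M[C]_n) x : V \is unitarymx ->
  mxfun f (hdiag V x) = hdiag V (f \o x).
Proof.
move=> Vu; set A := hdiag V x; rewrite /mxfun.
have hA : A \is hermsymmx by apply/hermsymP; rewrite adj_hdiag.
have /orthomx_spectralP AE := hermitian_normalmx hA.
have Uu := spectral_unitarymx A.
move: AE Uu; set U := spectralmx A; set s := spectral_diag A => AE Uu.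
rewrite (invmx_unitary Uu) in AE *.
set W := U *m V^t*.
have WV : W *m V = U by rewrite -mulmxA unitary_adjl // mulmx1.
have com : diag_mx s *m W = W *m diag_mx (\row_j (x j)%:C).
  have : U *m A *m V^t* = W *m diag_mx (\row_j (x j)%:C).
    by rewrite /A /hdiag /W -!mulmxA (unitarymxP Vu) mulmx1.
  by rewrite AE !mulmxA (unitarymxP Uu) mul1mx -mulmxA.
have WE : W = U *m V^t* by [].
clearbody W.
have comf : diag_mx (map_mx (fun z : C => (f (complex.Re z))%:C) s) *m W =
            W *m diag_mx (\row_j (f (x j))%:C).
  apply/matrixP => i j; rewrite mul_diag_mx mul_mx_diag !mxE.
  move/matrixP/(_ i j): com; rewrite mul_diag_mx mul_mx_diag !mxE.
  have [->|W0] := eqVneq (W i j) 0; first by rewrite !(mulr0, mul0r).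
  move=> sW; have -> : s 0 i = (x j)%:C. apply: (mulfI W0). by rewrite mulrC.
  by rewrite mulrC.
rewrite -[X in _ *m X]WV -!mulmxA [diag_mx _ *m _]mulmxA comf.
by rewrite !mulmxA WE mulmxA (unitary_adjl Uu) mul1mx.
Qed.

End Positive.

(** * Functional calculus *)

Section Calculus.
Variable R : realType.
Local Notation C := R[i].

(** The Loewner order. *)
Definition lemx n (A B : 'M[C]_n) : Prop := psdmx (B - A).

Lemma psdmx_lemx n (A : 'M[C]_n) : psdmx A <-> lemx 0 A.
Proof. by rewrite /lemx subr0. Qed.

Lemma lemxx n (A : 'M[C]_n) : lemx A A.
Proof. by rewrite /lemx subrr; exact: psdmx0. Qed.

Lemma lemx_trans n (B A D : 'M[C]_n) : lemx A B -> lemx B D -> lemx A D.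
Proof. by move=> AB BD; have := psdmxD BD AB; rewrite addrA subrK. Qed.

Lemma lemxD n (A B A' B' : 'M[C]_n) :
  lemx A B -> lemx A' B' -> lemx (A + A') (B + B').
Proof. by rewrite /lemx opprD addrACA; exact: psdmxD. Qed.

Lemma lemxZ n (a : R) (A B : 'M[C]_n) : 0 <= a ->
  lemx A B -> lemx (a%:C *: A) (a%:C *: B).
Proof. by move=> a0 AB; rewrite /lemx -scalerBr; exact: psdmxZ. Qed.

Lemma lemx_conj m n (W : 'M[C]_(m, n)) (A B : 'M[C]_m) :
  lemx A B -> lemx (W^t* *m A *m W) (W^t* *m B *m W).
Proof. by move=> AB; rewrite /lemx -mulmxBl -mulmxBr; exact: psdmx_conj. Qed.

Lemma lemx_psdl n (A B : 'M[C]_n) : psdmx A -> lemx A B -> psdmx B.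
Proof. by rewrite !psdmx_lemx; exact: lemx_trans. Qed.

Lemma mxfun_adj (f : R -> R) n (A : 'M[C]_n) : A^t* = A ->
  (mxfun f A)^t* = mxfun f A.
Proof.
by move=> /hermitian_hdiag[V [x [Vu ->]]]; rewrite mxfun_hdiag // adj_hdiag.
Qed.

Lemma mxfunM (f g : R -> R) n (A : 'M[C]_n) : A^t* = A ->
  mxfun f A *m mxfun g A = mxfun (fun x => f x * g x) A.
Proof.
by move=> /hermitian_hdiag[V [x [Vu ->]]]; rewrite !mxfun_hdiag // mul_hdiag.
Qed.

Lemma mxfunB (f g : R -> R) n (A : 'M[C]_n) : A^t* = A ->
  mxfun f A - mxfun g A = mxfun (fun x => f x - g x) A.
Proof.
by move=> /hermitian_hdiag[V [x [Vu ->]]]; rewrite !mxfun_hdiag // hdiagB.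
Qed.

Lemma mxfunZ a (f : R -> R) n (A : 'M[C]_n) : A^t* = A ->
  a%:C *: mxfun f A = mxfun (fun x => a * f x) A.
Proof.
by move=> /hermitian_hdiag[V [x [Vu ->]]]; rewrite !mxfun_hdiag // hdiagZ.
Qed.

Lemma mxfun_id n (A : 'M[C]_n) : A^t* = A -> mxfun id A = A.
Proof. by move=> /hermitian_hdiag[V [x [Vu ->]]]; rewrite mxfun_hdiag. Qed.

Lemma mxfun_cst1 n (A : 'M[C]_n) : A^t* = A -> mxfun (fun=> 1) A = 1%:M.
Proof.
by move=> /hermitian_hdiag[V [x [Vu ->]]]; rewrite mxfun_hdiag // hdiag1.
Qed.

Lemma mxfun_mulr (f : R -> R) n (A : 'M[C]_n) : A^t* = A ->
  mxfun f A *m A = mxfun (fun x => f x * x) A.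
Proof. by move=> hA; rewrite -{2}(mxfun_id hA) (mxfunM f id hA). Qed.

Lemma mxfun_psd (f : R -> R) n (A : 'M[C]_n) : psdmx A ->
  (forall x, 0 <= x -> 0 <= f x) -> psdmx (mxfun f A).
Proof.
move=> /psd_hdiag[V [x [Vu -> x0]]] f0; rewrite mxfun_hdiag //.
by apply: hdiag_psd => i; exact: f0.
Qed.

Lemma mxfun_le (f g : R -> R) n (A : 'M[C]_n) : psdmx A ->
  (forall x, 0 <= x -> f x <= g x) -> lemx (mxfun f A) (mxfun g A).
Proof.
move=> Ap fg; rewrite /lemx mxfunB; last exact: psdmx_adj.
by apply: mxfun_psd => // x x0; rewrite subr_ge0 fg.
Qed.

Lemma mxfun_tens (f : R -> R) m n (A : 'M[C]_m) (B : 'M[C]_n) :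
  psdmx A -> psdmx B ->
  (forall x y, 0 <= x -> 0 <= y -> f (x * y) = f x * f y) ->
  mxfun f (A *t B) = mxfun f A *t mxfun f B.
Proof.
move=> /psd_hdiag[V [x [Vu -> x0]]] /psd_hdiag[W [y [Wu -> y0]]] fM.
rewrite tens_hdiag (mxfun_hdiag f _ (unitarymx_tens Vu Wu)).
rewrite (mxfun_hdiag f x Vu) (mxfun_hdiag f y Wu) tens_hdiag.
by congr hdiag; apply/funext => i /=; exact: fM.
Qed.

End Calculus.

(** * Tensor powers *)

Section TensorPower.
Variable R : realType.
Local Notation C := R[i].

Lemma ntensmx_psd d (A : 'M[C]_d) n : psdmx A -> psdmx (ntensmx A n).
Proof.
move=> Ap; case: n => [|n]; first exact: psdmx1.
by elim: n => [|n IH]; rewrite ?ntensmx1 // ntensmxSS; exact: psdmx_tens.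
Qed.

Lemma ntensmxM d (A B : 'M[C]_d) n :
  ntensmx A n *m ntensmx B n = ntensmx (A *m B) n.
Proof.
case: n => [|n]; first exact: (mulmx1 (1%:M : 'M[C]_1)).
by elim: n => [|n IH]; rewrite ?ntensmx1 // !ntensmxSS tensmx_mul IH.
Qed.

Lemma mxtrace_ntens d (A : 'M[C]_d) n : \tr (ntensmx A n) = \tr A ^+ n.
Proof.
case: n => [|n]; first exact: (mxtrace1 _ 1).
elim: n => [|n IH]; first by rewrite ntensmx1 expr1.
by rewrite !ntensmxSS mxtrace_tens IH [RHS]exprS.
Qed.

Lemma ntensmxZ d a (A : 'M[C]_d) n :
  ntensmx (a *: A) n = a ^+ n *: ntensmx A n.
Proof.
case: n => [|n]; first by rewrite expr0 scale1r.
elim: n => [|n IH]; first by rewrite !ntensmx1 ?expr1.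
by rewrite !ntensmxSS tensmxZl IH tensmxZr scalerA -exprS.
Qed.

(** One factor is exchanged at a time, through [A *t ntensmx B n.+1]; each difference is a tensor
    product of positive matrices. *)
Lemma ntensmx_le d (A B : 'M[C]_d) n : psdmx A -> lemx A B ->
  lemx (ntensmx A n) (ntensmx B n).
Proof.
move=> Ap AB; have Bp := lemx_psdl Ap AB; case: n => [|n].
  by rewrite !ntensmx0; exact: lemxx.
elim: n => [|n IH]; first by rewrite !ntensmx1 ?expr1.
rewrite !ntensmxSS; apply: (@lemx_trans _ _ (A *t ntensmx B n.+1)).
  by rewrite /lemx -tensmxBr; exact: psdmx_tens.
by rewrite /lemx -tensmxBl; apply: psdmx_tens => //; exact: ntensmx_psd.
Qed.

(** Serves the support indicator and the powers x^s, both multiplicative on nonnegative reals; their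
    expectations on n copies thereby become n-th powers. *)
Lemma mxfun_ntens (f : R -> R) d (A : 'M[C]_d) n : psdmx A -> f 1 = 1 ->
  (forall x y, 0 <= x -> 0 <= y -> f (x * y) = f x * f y) ->
  mxfun f (ntensmx A n) = ntensmx (mxfun f A) n.
Proof.
move=> Ap f1 fM; case: n => [|n].
  have one_u : (1%:M : 'M[C]_(d ^ 0)) \is unitarymx.
    by apply/unitarymxP; rewrite adjmx1 mulmx1.
  rewrite !ntensmx0 -[1 in LHS](hdiag1 one_u) mxfun_hdiag //.
  by rewrite -[1 in RHS](hdiag1 one_u); congr hdiag; apply/funext => i /=.
elim: n => [|n IH]; first by rewrite !ntensmx1 ?expr1.
have := mxfun_tens Ap (ntensmx_psd n.+1 Ap) fM.
by rewrite !ntensmxSS IH.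
Qed.

Lemma ntensmx_density d (rho : 'M[C]_d) n :
  density rho -> density (ntensmx rho n).
Proof.
move=> [rp r1]; split; first exact: ntensmx_psd.
by rewrite mxtrace_ntens r1 expr1n.
Qed.

End TensorPower.

(** * Real traces and spectral weights *)

Section RealTrace.
Variable R : realType.
Local Notation C := R[i].

(** Keeps inequalities in [R]; nothing is lost on positive matrices and on products of two of them,
    whose traces are real. *)
Definition rtr n (A : 'M[C]_n) : R := complex.Re (\tr A).

Lemma rtrD n (A B : 'M[C]_n) : rtr (A + B) = rtr A + rtr B.
Proof. by rewrite /rtr mxtraceD; case: (\tr A) (\tr B) => ? ? []. Qed.

Lemma rtrB n (A B : 'M[C]_n) : rtr (A - B) = rtr A - rtr B.
Proof. by rewrite /rtr linearB /=; case: (\tr A) (\tr B) => ? ? []. Qed.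

Lemma rtrZ n (a : R) (A : 'M[C]_n) : rtr (a%:C *: A) = a * rtr A.
Proof. by rewrite /rtr mxtraceZ; case: (\tr A) => x y /=; rewrite mul0r subr0. Qed.

Lemma rtr_mulC m n (A : 'M[C]_(m, n)) (B : 'M[C]_(n, m)) :
  rtr (A *m B) = rtr (B *m A).
Proof. by rewrite /rtr mxtrace_mulC. Qed.

Lemma rtr_ge0 n (A : 'M[C]_n) : psdmx A -> 0 <= rtr A.
Proof. by move=> /mxtrace_psd_ge0; rewrite lecE => /andP[]. Qed.

Lemma rtr_mul_ge0 n (A B : 'M[C]_n) : psdmx A -> psdmx B -> 0 <= rtr (A *m B).
Proof. by move=> Ap /(mxtrace_psd_mul_ge0 Ap); rewrite lecE => /andP[]. Qed.

Lemma mxtrace_rtr n (A : 'M[C]_n) : psdmx A -> \tr A = (rtr A)%:C.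
Proof. by move=> /mxtrace_psd_ge0/ger0_real/RRe_real. Qed.

Lemma mxtrace_mul_rtr n (A B : 'M[C]_n) : psdmx A -> psdmx B ->
  \tr (A *m B) = (rtr (A *m B))%:C.
Proof. by move=> Ap /(mxtrace_psd_mul_ge0 Ap)/ger0_real/RRe_real. Qed.

Lemma rtr_le n (A B : 'M[C]_n) : lemx A B -> rtr A <= rtr B.
Proof. by move=> /rtr_ge0; rewrite rtrB subr_ge0. Qed.

Lemma rtr_mul_le n (P A B : 'M[C]_n) : psdmx P -> lemx A B ->
  rtr (P *m A) <= rtr (P *m B).
Proof. by move=> Pp /(rtr_mul_ge0 Pp); rewrite mulmxBr rtrB subr_ge0. Qed.

Lemma rtr_density n (rho : 'M[C]_n) : density rho -> rtr rho = 1.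
Proof. by case=> _ r1; rewrite /rtr r1. Qed.

Lemma densityE n (rho : 'M[C]_n) : psdmx rho -> rtr rho = 1 -> density rho.
Proof. by move=> rp r1; split=> //; rewrite mxtrace_rtr // r1. Qed.

Lemma rtr_ntens_mul d (A B : 'M[C]_d) n : psdmx A -> psdmx B ->
  rtr (ntensmx A n *m ntensmx B n) = rtr (A *m B) ^+ n.
Proof.
move=> Ap Bp; rewrite ntensmxM /rtr mxtrace_ntens mxtrace_mul_rtr //.
by rewrite -rmorphXn.
Qed.

(** The outcome law of the observable [B] in the state [rho]: [w] is the diagonal of [rho] in an
    eigenbasis of [B]. The same weights serve every [f], which reduces moments to classical sums. *)
Lemma rtr_mxfun_weights n (rho B : 'M[C]_n) : psdmx rho -> psdmx B ->
  exists w b : 'I_n -> R, [/\ forall i, 0 <= w i, forall i, 0 <= b i &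
    forall f, rtr (rho *m mxfun f B) = \sum_i w i * f (b i)].
Proof.
move=> rp /psd_hdiag[V [b [Vu -> b0]]].
have Wp : psdmx (V *m rho *m V^t*).
  by have := psdmx_conj (V^t*) rp; rewrite trmxCK.
exists (fun i => complex.Re ((V *m rho *m V^t*) i i)), b; split => //.
  move=> i; case: Wp => _ /(_ (delta_mx 0 i)).
  have -> : (delta_mx 0 i : 'rV[C]_n)^t* = delta_mx i 0.
    by apply/matrixP => j k; rewrite !mxE andbC; case: (_ && _);
      rewrite ?rmorph1 ?rmorph0.
  by rewrite -rowE -colE !mxE lecE => /andP[].
move=> f; rewrite mxfun_hdiag // /hdiag !mulmxA rtr_mulC !mulmxA /rtr.
rewrite /mxtrace (raddf_sum (@complex.Re R : Rcomplex R -> R)) /=.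
apply: eq_bigr => i _; rewrite mul_mx_diag !mxE.
by case: (\sum__ _) => x y /=; rewrite mulr0 subr0.
Qed.

End RealTrace.

(** * Chernoff bounds for tensor powers *)

Section Concentration.
Variable R : realType.
Local Notation C := R[i].

Lemma expR_le_quadratic (y : R) : y <= 1 / 2 -> expR y <= 1 + y + 2 * y ^+ 2.
Proof.
move=> y2; have : 1 - y <= expR (- y) by exact: expR_ge1Dx.
rewrite expRN => H.
have e0 := expR_gt0 y; have y1 : 0 < 1 - y by lra.
have : expR y <= (1 - y)^-1 by rewrite -[expR y]invrK lef_pV2 ?posrE ?invr_gt0.
move=> /le_trans; apply.
rewrite -[(1 - y)^-1]mul1r ler_pdivrMr //.
have -> : (1 + y + 2 * y ^+ 2) * (1 - y) = 1 + y ^+ 2 * (1 - 2 * y) by ring.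
by rewrite lerDl mulr_ge0 ?sqr_ge0 //; lra.
Qed.

(* The exponent s is a small multiple of -(m - ln th), the first-order decrease
   direction of s |-> E[(b/th)^s] at s = 0. *)
Lemma moment_lt1 d (w b : 'I_d -> R) (th : R) :
  (forall i, 0 <= w i) -> (forall i, 0 <= b i) -> 0 < th ->
  \sum_i w i = 1 -> \sum_i w i * (b i != 0)%:R = 1 ->
  \sum_i w i * ln (b i) != ln th ->
  exists s, s * (\sum_i w i * ln (b i) - ln th) < 0 /\
    (\sum_i w i * (b i `^ s)) * th `^ (- s) < 1.
Proof.
move=> w0 b0 th0 w1 wb1 mth.
(* No weight sits on the eigenvalue 0, where [ln] only has its default value. *)
have wz i : b i = 0 -> w i = 0.
  move=> bi; have : \sum_i w i * (1 - (b i != 0)%:R) = 0.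
    transitivity (\sum_i w i - \sum_i w i * (b i != 0)%:R).
      2: by rewrite w1 wb1 subrr.
    by rewrite -sumrB; apply: eq_bigr => j _; rewrite mulrBr mulr1.
  have pos j : true -> 0 <= w j * (1 - (b j != 0)%:R).
    by move=> _; rewrite mulr_ge0 // subr_ge0; case: (b j != 0).
  by move/(psumr_eq0P pos)/(_ i isT); rewrite bi eqxx /= subr0 mulr1.
set m := \sum_i w i * ln (b i) - ln th.
have m0 : m != 0 by rewrite subr_eq0.
pose y i := ln (b i) - ln th.
pose Y := \sum_i `|y i|.
pose M := \sum_i w i * y i ^+ 2.
have Y0 : 0 <= Y by apply: sumr_ge0.
have M0 : 0 <= M by apply: sumr_ge0 => i _; rewrite mulr_ge0 ?sqr_ge0.
(* The term [|m| * Y] keeps every [s * y i] within the range of the quadratic bound; the term [M]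
   with the extra 1 gives 2tM < 1, so the second-order loss stays below the first-order gain t
   m^2. *)
pose t := (2 * (M + `|m| * Y + 1))^-1.
have D0 : 0 < M + `|m| * Y + 1.
  by rewrite ltr_wpDl // addr_ge0 // mulr_ge0.
have t0 : 0 < t by rewrite invr_gt0 mulr_gt0.
have tE : t * (2 * (M + `|m| * Y + 1)) = 1.
  by rewrite mulVf // gt_eqF // mulr_gt0.
have msq : 0 < m ^+ 2 by rewrite exprn_even_gt0.
exists (- (t * m)); split.
  by rewrite mulNr oppr_lt0 -mulrA -expr2 mulr_gt0.
set s := - (t * m).
have sy i : s * y i <= 1 / 2.
  apply: (le_trans (ler_norm _)); rewrite normrM /s normrN normrM (gtr0_norm t0).
  have yY : `|y i| <= Y by rewrite /Y (bigD1 i) //= lerDl sumr_ge0.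
  have : t * (`|m| * `|y i|) <= t * (`|m| * Y).
    by apply: ler_wpM2l; [exact: ltW | exact: ler_wpM2l].
  have : t * (`|m| * Y) <= t * (M + `|m| * Y + 1).
    by apply: ler_wpM2l; [exact: ltW | lra].
  by move: tE; rewrite mulrCA; lra.
have term i : w i * b i `^ s * th `^ (- s) <=
              w i * (1 + s * y i + 2 * (s * y i) ^+ 2).
  have [bi|bi] := eqVneq (b i) 0; first by rewrite wz // !mul0r.
  rewrite -mulrA ler_wpM2l //; have -> : b i `^ s * th `^ (- s) = expR (s * y i).
    rewrite /powR (negPf bi) (gt_eqF th0) -expRD /y; congr expR; ring.
  exact: expR_le_quadratic.
rewrite mulr_suml; apply: (le_lt_trans (ler_sum _ (fun i _ => term i))).
have -> : \sum_i w i * (1 + s * y i + 2 * (s * y i) ^+ 2) =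
          1 + s * m + 2 * s ^+ 2 * M.
  have -> : m = \sum_i w i * y i.
    rewrite /m -[ln th]mul1r -w1 mulr_suml -sumrB.
    by apply: eq_bigr => i _; rewrite mulrBr.
  transitivity (\sum_i w i + s * (\sum_i w i * y i) + 2 * s ^+ 2 * M).
    2: by rewrite w1.
  rewrite /M !mulr_sumr -!big_split /=.
  by apply: eq_bigr => i _; ring.
have -> : 1 + s * m + 2 * s ^+ 2 * M = 1 - t * m ^+ 2 * (1 - 2 * t * M).
  by rewrite /s; ring.
rewrite ltrBlDr ltrDl; apply: mulr_gt0; first exact: mulr_gt0.
rewrite subr_gt0.
have : 0 <= t * (`|m| * Y) by rewrite mulr_ge0 ?mulr_ge0 // ltW.
by move: tE t0; lra.
Qed.

Lemma powR_exprn (th s : R) n : 0 < th -> (th ^+ n) `^ s = (th `^ s) ^+ n.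
Proof.
move=> th0; elim: n => [|n IH]; first by rewrite !expr0 powR1.
by rewrite !exprS powRM ?IH // ?exprn_ge0 // ltW.
Qed.

(** Markov's inequality for x^s: the kernel term [1 - (x != 0)%:R] has expectation 0, and the
    normalised moment is an n-th power of a number below 1. The sign of [s] decides which tail is
    controlled, so [h] is left open to cover both. *)
Lemma tail_bound d (rho B : 'M[C]_d) (th : R) :
  density rho -> psdmx B -> rtr (rho *m mxfun (fun x => (x != 0)%:R) B) = 1 ->
  0 < th -> rtr (rho *m mxfun (@ln R) B) != ln th ->
  exists s r, [/\ s * (rtr (rho *m mxfun (@ln R) B) - ln th) < 0, 0 <= r < 1 &
    forall n (h : R -> R),
      (forall x, 0 <= x -> h x <= 1 - (x != 0)%:R + x `^ s / (th ^+ n) `^ s) ->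
      rtr (ntensmx rho n *m mxfun h (ntensmx B n)) <= r ^+ n].
Proof.
move=> dr Bp sB th0; have [rp _] := dr.
have [w [b [w0 b0 wE]]] := rtr_mxfun_weights rp Bp.
have w1 : \sum_i w i = 1.
  have := wE (fun=> 1); rewrite mxfun_cst1 ?mulmx1 ?rtr_density //; last first.
    exact: psdmx_adj.
  by move=> ->; apply: eq_bigr => i _; rewrite mulr1.
have wb1 := esym (etrans (esym sB) (wE _)).
move=> mth.
rewrite (wE (@ln R)) in mth *.
have [s [sm lt1]] := moment_lt1 w0 b0 th0 w1 wb1 mth.
exists s, (rtr (rho *m mxfun (fun x => x `^ s) B) * th `^ (- s)).
have Bsp : psdmx (mxfun (fun x => x `^ s) B).
  by apply: mxfun_psd => // x _; exact: powR_ge0.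
split => //.
  rewrite wE lt1 andbT mulr_ge0 ?powR_ge0 // sumr_ge0 // => i _.
  by rewrite mulr_ge0 ?powR_ge0.
move=> n h hle; have Bnp := ntensmx_psd n Bp; have hBn := psdmx_adj Bnp.
have rnp := ntensmx_psd n rp.
have s0 : s != 0 by apply: contraTneq sm => ->; rewrite mul0r ltxx.
set u := ((th ^+ n) `^ s)^-1.
pose nz (x : R) : R := (x != 0)%:R; pose pw (x : R) := x `^ s.
pose F := mxfun nz (ntensmx B n); pose G := mxfun pw (ntensmx B n).
have F1 : rtr (ntensmx rho n *m F) = 1.
  rewrite /F mxfun_ntens //; last 2 first.
  - by rewrite /nz oner_eq0.
  - by move=> x y _ _; rewrite /nz mulf_eq0 negb_or -mulnb natrM.
  have Sp : psdmx (mxfun nz B) by apply: mxfun_psd => // x _; exact: ler0n.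
  by rewrite (rtr_ntens_mul n rp Sp) sB expr1n.
have G1 : rtr (ntensmx rho n *m G) = rtr (rho *m mxfun pw B) ^+ n.
  rewrite /G mxfun_ntens ?(rtr_ntens_mul n rp Bsp) //; first by rewrite /pw powR1.
  by move=> x y x0 y0; rewrite /pw powRM.
have hFG : lemx (mxfun h (ntensmx B n)) (1%:M - F - (- u)%:C *: G).
  rewrite -(mxfun_cst1 hBn) /F /G (mxfunZ _ _ hBn) (mxfunB _ nz hBn).
  rewrite (mxfunB _ (fun x => - u * pw x) hBn).
  apply: mxfun_le => // x x0; apply: le_trans (hle x x0) _.
  by rewrite /pw mulNr opprK mulrC.
move: F1 G1 hFG; clearbody F G => F1 G1 /(rtr_mul_le rnp)/le_trans; apply.
rewrite !mulmxBr mulmx1 -scalemxAr !rtrB rtrZ F1 G1.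
rewrite (rtr_density (ntensmx_density n dr)) subrr add0r mulNr opprK.
by rewrite exprMn mulrC powRN exprVn -powR_exprn.
Qed.

End Concentration.

(** * Trace norm *)

Section TraceNorm.
Variable R : realType.
Local Notation C := R[i].

Lemma trace_norm_ge0 n (A : 'M[C]_n) : 0 <= trace_norm A.
Proof.
by apply: rtr_ge0; apply: mxfun_psd => [|x _]; [exact: psdmx_gram|exact: sqrtr_ge0].
Qed.

Lemma trace_norm_herm n (A : 'M[C]_n) : A^t* = A ->
  trace_norm A = rtr (mxfun (fun x => `|x|) A).
Proof.
move=> /hermitian_hdiag[V [x [Vu ->]]]; rewrite /trace_norm adj_hdiag.
rewrite (mul_hdiag x x Vu) (mxfun_hdiag Num.sqrt _ Vu).
rewrite (mxfun_hdiag (fun x => `|x|) x Vu) /rtr.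
congr (complex.Re (\tr (hdiag V _))).
by apply/funext => i /=; rewrite -expr2 sqrtr_sqr.
Qed.

(* Split the trace along the spectral projections of A onto its nonnegative and
   negative parts, using A <= B on the first and -A <= B on the second. *)
Lemma trace_norm_le n (A B : 'M[C]_n) : A^t* = A ->
  lemx A B -> lemx (- A) B -> trace_norm A <= rtr B.
Proof.
move=> hA AB NAB; rewrite trace_norm_herm //.
pose p (x : R) : R := (0 <= x)%R%:R; pose m (x : R) : R := 1 - (0 <= x)%R%:R.
have proj_psd (f : R -> R) : (forall x, f x * f x = f x) -> psdmx (mxfun f A).
  move=> ff; have <- : mxfun (fun x => f x * f x) A = mxfun f A.
    by congr (mxfun _ A); exact/funext.
  by rewrite -(mxfunM f f hA) -{1}(mxfun_adj f hA); exact: psdmx_gram.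
have Pp : psdmx (mxfun p A).
  by apply: proj_psd => x; rewrite /p; case: (0 <= x); rewrite ?mulr1 ?mulr0.
have Mp : psdmx (mxfun m A).
  apply: proj_psd => x; rewrite /m; case: (0 <= x); first by rewrite subrr mulr0.
  by rewrite subr0 mulr1.
have absE : mxfun (fun x => `|x|) A = mxfun p A *m A - mxfun m A *m A.
  have Ep := mxfun_mulr p hA; have Em := mxfun_mulr m hA.
  apply: etrans (congr2 (fun X Y => X - Y) (esym Ep) (esym Em)).
  apply: etrans (esym (mxfunB (fun x => p x * x) (fun x => m x * x) hA)).
  congr (mxfun _ A); apply/funext => x; rewrite /p /m /=; case: (leP 0 x) => x0.
    by rewrite ger0_norm // mul1r subrr mul0r subr0.
  by rewrite ltr0_norm // mul0r subr0 mul1r sub0r.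
have oneE : 1%:M - mxfun p A = mxfun m A.
  by rewrite -(mxfun_cst1 hA) (mxfunB (fun=> 1) p hA).
move: (mxfun p A) (mxfun m A) absE oneE Pp Mp => P M -> PM Pp Mp.
have -> : B = P *m B + M *m B by rewrite -PM mulmxBl mul1mx addrC subrK.
rewrite rtrB rtrD lerD //; first exact: rtr_mul_le.
have := rtr_mul_le Mp NAB; rewrite mulmxN -[- (M *m A)]sub0r rtrB.
by rewrite /rtr mxtrace0 /= sub0r.
Qed.

End TraceNorm.

(** * Measure-and-prepare channels *)

Section MeasurePrepare.
Variable R : realType.
Local Notation C := R[i].

Lemma ampliationE k d e (L : 'M[C]_d -> 'M[C]_e) X i a j b :
  ampliation (k := k) L X (mxtens_index (i, a)) (mxtens_index (j, b)) =
  L (mxblk X i j) a b.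
Proof.
rewrite /ampliation summxE (bigD1 i) //= [X in _ + X]big1 ?addr0 => [|i' ne].
  rewrite summxE (bigD1 j) //= [X in _ + X]big1 ?addr0 => [|j' ne].
    by rewrite tensmxE !mxE !eqxx mul1r.
  by rewrite tensmxE !mxE [j == _]eq_sym (negPf ne) andbF mul0r.
rewrite summxE big1 // => j' _.
by rewrite tensmxE !mxE [i == _]eq_sym (negPf ne) mul0r.
Qed.

Lemma sum_mxtens_index k d (f : 'I_(k * d) -> C) :
  \sum_q f q = \sum_i \sum_a f (mxtens_index (i, a)).
Proof.
rewrite pair_bigA /=; rewrite (reindex (@mxtens_index k d)) /=.
  by apply: eq_bigr => -[i a] _.
by exists (@mxtens_unindex k d) => q _; rewrite ?mxtens_indexK ?mxtens_unindexK.
Qed.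

Lemma psdmx_sum I (s : seq I) n (F : I -> 'M[C]_n) :
  (forall i, psdmx (F i)) -> psdmx (\sum_(i <- s) F i).
Proof.
move=> Fp; elim/big_ind: _ => [|A B Ap Bp|i _].
- exact: psdmx0.
- exact: psdmxD.
- exact: Fp.
Qed.

(** The identity on the first factor tensored with the functional tr(T .) on the second. *)
Definition partial_mean k d (T : 'M[C]_d) (X : 'M[C]_(k * d)) : 'M[C]_k :=
  \matrix_(i, j) \tr (T *m mxblk X i j).

(* With T = W^* W, this is the sum of the compressions of X by the maps
   1 (x) <row l W|. *)
Lemma partial_mean_psd k d (T : 'M[C]_d) (X : 'M[C]_(k * d)) :
  psdmx T -> psdmx X -> psdmx (partial_mean T X).
Proof.
move=> /psdmx_root[W ->] Xp.
pose F l : 'M[C]_(k, k * d) := \matrix_(i, q)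
  (((mxtens_unindex q).1 == i)%:R * W l (mxtens_unindex q).2).
have -> : partial_mean (W^t* *m W) X = \sum_l F l *m X *m (F l)^t*.
  apply/matrixP => i j; rewrite mxE -mulmxA mxtrace_mulC summxE.
  rewrite /mxtrace; apply: eq_bigr => l _.
  have FX q : (F l *m X) i q = \sum_a W l a * X (mxtens_index (i, a)) q.
    rewrite mxE sum_mxtens_index (bigD1 i) //= [X in _ + X]big1 ?addr0.
      by apply: eq_bigr => a _; rewrite !mxE !mxtens_indexK eqxx mul1r.
    move=> i' /negPf ne; rewrite big1 // => a _.
    by rewrite !mxE !mxtens_indexK ne !mul0r.
  rewrite [RHS]mxE sum_mxtens_index (bigD1 j) //= [X in _ = _ + X]big1 ?addr0.
    rewrite mxE; apply: eq_bigr => b _; rewrite FX !mxE !mxtens_indexK eqxx mul1r.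
    by congr (_ * _); apply: eq_bigr => a _; rewrite !mxE.
  move=> j' /negPf ne; rewrite big1 // => b _.
  by rewrite !mxE !mxtens_indexK ne mul0r rmorph0 mulr0.
apply: psdmx_sum => l; have := psdmx_conj ((F l)^t*) Xp.
by rewrite trmxCK.
Qed.

Definition measure_prepare d e (T : 'M[C]_d) (w0 w1 : 'M[C]_e) (X : 'M[C]_d) :=
  \tr (T *m X) *: w0 + \tr ((1%:M - T) *m X) *: w1.

Fact measure_prepare_linear d e T w0 w1 : linear (@measure_prepare d e T w0 w1).
Proof.
move=> a X Y; rewrite /measure_prepare !mulmxDr -!scalemxAr !mxtraceD !mxtraceZ.
by rewrite scalerDr !scalerA !scalerDl addrACA.
Qed.

HB.instance Definition _ d e T w0 w1 := GRing.isLinear.Build C 'M[C]_d 'M[C]_e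
  _ (@measure_prepare d e T w0 w1) (@measure_prepare_linear d e T w0 w1).

(** The ampliation splits into the partial means of [X] for the two effects [T] and [1 - T], each
    tensored with the state prepared on that outcome. *)
Lemma measure_prepare_cptp d e (T : 'M[C]_d) (w0 w1 : 'M[C]_e) :
  psdmx T -> lemx T 1%:M -> density w0 -> density w1 ->
  cptp (measure_prepare T w0 w1).
Proof.
move=> Tp T1 [w0p w01] [w1p w11]; split=> [k X Xp|X]; last first.
  rewrite /= /measure_prepare mxtraceD !mxtraceZ w01 w11 !mulr1 -mxtraceD.
  by rewrite -mulmxDl addrC subrK mul1mx.
have -> : ampliation (measure_prepare T w0 w1) X =
    partial_mean T X *t w0 + partial_mean (1%:M - T) X *t w1.
  apply/matrixP => p q; case: (mxtens_indexP p) => i a.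
  case: (mxtens_indexP q) => j b; rewrite ampliationE [RHS]mxE !tensmxE.
  by rewrite !mxE.
by apply: psdmxD; apply: psdmx_tens => //; apply: partial_mean_psd.
Qed.

Lemma measure_prepareE d e (T rho : 'M[C]_d) (w0 w1 : 'M[C]_e) :
  psdmx T -> density rho ->
  measure_prepare T w0 w1 rho =
  (rtr (T *m rho))%:C *: w0 + (1 - rtr (T *m rho))%:C *: w1.
Proof.
move=> Tp [rp r1]; rewrite /measure_prepare mulmxBl mul1mx linearB /= r1.
by rewrite (mxtrace_mul_rtr Tp rp) -rmorphB.
Qed.

End MeasurePrepare.

(** * Gentle measurement *)

Section Projections.
Variable R : realType.
Local Notation C := R[i].

Definition projmx n (P : 'M[C]_n) : Prop := P^t* = P /\ P *m P = P.

Lemma projmx_psd n (P : 'M[C]_n) : projmx P -> psdmx P.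
Proof. by move=> [hP PP]; rewrite -PP -{1}hP; exact: psdmx_gram. Qed.

Lemma projmx_compl n (P : 'M[C]_n) : projmx P -> projmx (1%:M - P).
Proof.
move=> [hP PP]; split; first by rewrite adjmxB adjmx1 hP.
by rewrite mulmxBl mul1mx mulmxBr mulmx1 PP subrr subr0.
Qed.

Lemma projmx_le1 n (P : 'M[C]_n) : projmx P -> lemx P 1%:M.
Proof. by move=> /projmx_compl/projmx_psd. Qed.

Lemma mxfun_projmx (p : pred R) n (A : 'M[C]_n) : A^t* = A ->
  projmx (mxfun (fun x => (p x)%:R) A).
Proof.
move=> hA; split; first exact: mxfun_adj.
apply: etrans (mxfunM _ _ hA) _.
by congr (mxfun _ A); apply/funext => x; case: (p x); rewrite ?mulr1 ?mulr0.
Qed.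

Lemma gramD m n (X Y : 'M[C]_(m, n)) : (X + Y) *m (X + Y)^t* =
  X *m X^t* + Y *m Y^t* + (X *m Y^t* + Y *m X^t*).
Proof. by rewrite adjmxD mulmxDl !mulmxDr [Y *m _ + _]addrC addrACA. Qed.

Lemma psdmx_gramr m n (X : 'M[C]_(m, n)) : psdmx (X *m X^t*).
Proof. by rewrite -{1}[X]trmxCK; exact: psdmx_gram. Qed.

Lemma psdmx_adjoint_root n (A : 'M[C]_n) : psdmx A ->
  exists W : 'M[C]_n, A = W *m W^t*.
Proof. by move=> /psdmx_root[W ->]; exists (W^t*); rewrite trmxCK. Qed.

(** Operator AM-GM: expand the positive Gram matrices of e X + (s/e) Y for s = 1 and s = -1. *)
Lemma gram_cross m n (e : R) (X Y : 'M[C]_(m, n)) : e != 0 ->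
  lemx (X *m Y^t* + Y *m X^t*)
       ((e ^+ 2)%:C *: (X *m X^t*) + (e ^- 2)%:C *: (Y *m Y^t*)) /\
  lemx (- (X *m Y^t* + Y *m X^t*))
       ((e ^+ 2)%:C *: (X *m X^t*) + (e ^- 2)%:C *: (Y *m Y^t*)).
Proof.
move=> e0; have cross (s : R) : s ^+ 2 = 1 ->
    psdmx ((e ^+ 2)%:C *: (X *m X^t*) + (e ^- 2)%:C *: (Y *m Y^t*) +
      s%:C *: (X *m Y^t* + Y *m X^t*)).
  move=> s1; have := psdmx_gramr (e%:C *: X + (s / e)%:C *: Y).
  rewrite gramD !adjmxZ -!scalemxAl -!scalemxAr !scalerA -!rmorphM.
  have -> : e * (s / e) = s by rewrite mulrC divfK.
  have -> : s / e * e = s by rewrite divfK.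
  have -> : s / e * (s / e) = e ^- 2.
    by rewrite mulrACA -expr2 s1 mul1r -invfM -expr2.
  by rewrite -expr2 scalerDr.
split; rewrite /lemx.
  have := cross (-1); rewrite sqrrN expr1n => /(_ erefl).
  by rewrite rmorphN rmorph1 scaleN1r.
by have := cross 1; rewrite expr1n => /(_ erefl); rewrite rmorph1 scale1r opprK.
Qed.

Lemma gram_parallelogram m n (X Y : 'M[C]_(m, n)) :
  lemx ((X + Y) *m (X + Y)^t*) ((X *m X^t* + Y *m Y^t*) *+ 2).
Proof.
rewrite gramD mulr2n; apply: lemxD; first exact: lemxx.
have [+ _] := gram_cross X Y (oner_neq0 R).
by rewrite expr1n invr1 rmorph1 !scale1r.
Qed.

Lemma rtr_gramD_le m n (X Y : 'M[C]_(m, n)) :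
  rtr ((X + Y) *m (X + Y)^t*) <= 2 * (rtr (X *m X^t*) + rtr (Y *m Y^t*)).
Proof.
have := rtr_le (gram_parallelogram X Y); rewrite mulr2n !rtrD.
by move: (rtr (X *m _)) (rtr (Y *m _)) => a b; rewrite mulr_natl mulr2n.
Qed.

Lemma gramN m n (X : 'M[C]_(m, n)) : (- X) *m (- X)^t* = X *m X^t*.
Proof.
by rewrite -[- X]sub0r adjmxB trmx0 map_mx0 !sub0r mulNmx mulmxN opprK.
Qed.

(** For rho = W W^*, the squared Hilbert-Schmidt norm of Q W is the probability of [Q] under rho. *)
Lemma rtr_compress m n (W : 'M[C]_(m, n)) (Q : 'M[C]_m) :
  Q^t* = Q -> Q *m Q = Q ->
  rtr ((Q *m W) *m (Q *m W)^t*) = rtr ((W *m W^t*) *m Q).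
Proof.
move=> hQ QQ; rewrite adjmxM hQ rtr_mulC !mulmxA -[_ *m Q *m Q]mulmxA QQ.
by rewrite rtr_mulC mulmxA.
Qed.

Lemma rtr_contract m n (W : 'M[C]_(m, n)) (Q : 'M[C]_m) : projmx Q ->
  rtr ((Q *m W) *m (Q *m W)^t*) <= rtr (W *m W^t*).
Proof.
move=> Qp; rewrite (rtr_compress W (proj1 Qp) (proj2 Qp)).
rewrite -[in leRHS](mulmx1 (_ *m _)).
by apply: rtr_mul_le; [exact: psdmx_gramr | exact: projmx_le1].
Qed.

Lemma lemxN n (A : 'M[C]_n) : psdmx A -> lemx (- A) A.
Proof. by move=> Ap; rewrite /lemx opprK; exact: (psdmxD Ap Ap). Qed.

(* QPQ is close to 1 on rho because 1 - QPQ = (1 - Q) + Q(1 - P)Q, where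
   Q = 1 - (1 - Q) inside the last term. *)
Lemma test_error n (rho P Q : 'M[C]_n) : psdmx rho -> projmx P -> projmx Q ->
  rtr (rho *m (1%:M - Q *m P *m Q)) <=
  2 * rtr (rho *m (1%:M - P)) + 3 * rtr (rho *m (1%:M - Q)).
Proof.
move=> /psdmx_adjoint_root[W rE] Pp Qp; have [hQ QQ] := Qp.
have P'p := projmx_compl Pp; have Q'p := projmx_compl Qp.
have -> : 1%:M - Q *m P *m Q = (1%:M - Q) + Q *m (1%:M - P) *m Q.
  by rewrite mulmxBr mulmx1 mulmxBl QQ addrA subrK.
have QE : Q *m W = W - (1%:M - Q) *m W by rewrite mulmxBl mul1mx subKr.
move: (1%:M - P) (1%:M - Q) P'p Q'p QE => P' Q' P'p Q'p QE.
have [hP' PP'] := P'p; have [hQ' QQ'] := Q'p.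
have e1 : rtr (rho *m (Q *m P' *m Q)) =
    rtr ((P' *m (Q *m W)) *m (P' *m (Q *m W))^t*).
  rewrite (rtr_compress (Q *m W) hP' PP').
  have -> : (Q *m W) *m (Q *m W)^t* *m P' = (Q *m rho) *m (Q *m P').
    by rewrite adjmxM hQ rE !mulmxA.
  by rewrite [RHS]rtr_mulC [LHS]rtr_mulC !mulmxA.
have e2 : P' *m (Q *m W) = P' *m W + - (P' *m (Q' *m W)).
  by rewrite QE mulmxBr.
(* The parallelogram bound doubles both errors; the term [1 - Q] adds one more error of [Q], whence
   the factors 2 and 3. *)
have i1 := rtr_gramD_le (P' *m W) (- (P' *m (Q' *m W))).
rewrite gramN in i1; have i2 := rtr_contract (Q' *m W) P'p.
have i3 := rtr_compress W hQ' QQ'; have i4 := rtr_compress W hP' PP'.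
rewrite mulmxDr rtrD e1 e2 {e1 e2 QE}.
rewrite -rE in i3 i4; rewrite i3 in i2; rewrite i4 in i1.
apply: le_trans (lerD (lexx _) i1) _.
move: (rtr (rho *m P')) (rtr (rho *m Q')) (rtr (_ *m _^t*)) i2 => a b c i2.
by clear -i2; lra.
Qed.

(* With rho = W W^* and Y = (QP - 1) W, the difference QP rho PQ - rho is
   W Y^* + Y W^* + Y Y^*, whose cross terms are split by AM-GM with weight v. *)
Lemma gentle_projection n (rho P Q w : 'M[C]_n) (v : R) :
  density rho -> projmx P -> projmx Q -> density w -> 0 < v -> v <= 1 ->
  rtr (rho *m (1%:M - P)) <= v ^+ 2 -> rtr (rho *m (1%:M - Q)) <= v ^+ 2 ->
  exists t : R, [/\ 0 <= t, t <= 18 * v,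
    density (Q *m (P *m rho *m P) *m Q + t%:C *: w) &
    trace_norm (Q *m (P *m rho *m P) *m Q + t%:C *: w - rho) <= 18 * v].
Proof.
move=> rd Pp Qp wd v0 v1 Pv Qv; have [rp _] := rd; have r1 := rtr_density rd.
have [wp _] := wd; have w1 := rtr_density wd.
have [hP PP] := Pp; have [hQ QQ] := Qp.
have [W rE] := psdmx_adjoint_root rp.
have P'p := projmx_compl Pp; have Q'p := projmx_compl Qp.
have w0E : Q *m (P *m rho *m P) *m Q = (Q *m (P *m W)) *m (Q *m (P *m W))^t*.
  by rewrite !adjmxM hQ hP rE !mulmxA.
have w0p := psdmx_gramr (Q *m (P *m W)); rewrite -w0E in w0p.
have w0le := le_trans (rtr_contract (P *m W) Qp) (rtr_contract W Pp).
rewrite -w0E -rE r1 in w0le.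
have YE : Q *m (P *m W) - W = - ((1%:M - Q) *m W + Q *m ((1%:M - P) *m W)).
  rewrite -[LHS]opprB; congr (- _).
  by rewrite !mulmxBl !mul1mx mulmxBr addrA subrK.
have Yv : rtr ((Q *m (P *m W) - W) *m (Q *m (P *m W) - W)^t*) <= 4 * v ^+ 2.
  rewrite YE gramN; apply: le_trans (rtr_gramD_le _ _) _.
  have i1 := rtr_contract ((1%:M - P) *m W) Qp.
  have i2 := rtr_compress W (proj1 P'p) (proj2 P'p).
  have i3 := rtr_compress W (proj1 Q'p) (proj2 Q'p).
  rewrite -rE in i2 i3; rewrite -i2 in Pv; rewrite -i3 in Qv.
  have := lerD Qv (le_trans i1 Pv); move: (_ + _) => c ci.
  by clear -ci; lra.
have w0D : Q *m (P *m rho *m P) *m Q - rho =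
    (W *m (Q *m (P *m W) - W)^t* + (Q *m (P *m W) - W) *m W^t*) +
    (Q *m (P *m W) - W) *m (Q *m (P *m W) - W)^t*.
  have -> : Q *m (P *m rho *m P) *m Q =
      (W + (Q *m (P *m W) - W)) *m (W + (Q *m (P *m W) - W))^t*.
    by rewrite [W + _]addrC subrK.
  by rewrite gramD -rE -[rho + _ + _]addrA addrAC subrr add0r addrC.
move: (Q *m (P *m rho *m P) *m Q) (Q *m (P *m W) - W) w0p w0le Yv w0D.
move=> w0 Y w0p w0le Yv w0D {w0E YE}.
have YYp := psdmx_gramr Y; have Y0 := rtr_ge0 YYp.
have v0' := ltW v0; have vi0 : 0 <= v^-1 by rewrite invr_ge0.
(* [gram_cross] weighs by squares, so the weight [v] comes from its root. *)
pose e := Num.sqrt v; have e0 : e != 0 by rewrite gt_eqF // sqrtr_gt0.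
have ev : e ^+ 2 = v by rewrite sqr_sqrtr // ltW.
have [cr1 cr2] := gram_cross W Y e0; rewrite ev -rE in cr1 cr2.
have [B [B1 B2 Bp rB]] : exists B : 'M[C]_n, [/\ lemx (w0 - rho) B,
    lemx (- (w0 - rho)) B, psdmx B &
    rtr B = v + v^-1 * rtr (Y *m Y^t*) + rtr (Y *m Y^t*)].
  exists (v%:C *: rho + v^-1%:C *: (Y *m Y^t*) + Y *m Y^t*); split.
  - by rewrite w0D; exact: (lemxD cr1 (lemxx _)).
  - rewrite w0D opprD; apply: (lemxD cr2 _).
    exact: lemxN YYp.
  - exact: (psdmxD (psdmxD (psdmxZ v0' rp) (psdmxZ vi0 YYp)) YYp).
  - by rewrite !rtrD !rtrZ r1 mulr1.
(* The trace is at most v + 4v + 4v^2, and v^2 is at most v. *)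
have Bv : rtr B <= 9 * v.
  rewrite rB; move: (rtr _) Yv Y0 => y Yv Y0.
  have h1 : v^-1 * y <= v^-1 * (4 * v ^+ 2).
    by rewrite ler_wpM2l // invr_ge0 ltW.
  have h2 : v^-1 * (4 * v ^+ 2) = 4 * v by field; rewrite gt_eqF.
  have h3 : v ^+ 2 <= v by rewrite expr2 ler_piMr // ltW.
  by clear -h1 h2 h3 Yv; lra.
(* The trace lost to the projections; returning it as a multiple of [w] restores normalisation and
   costs at most another 9v in trace norm. *)
pose t := 1 - rtr w0.
have t0 : 0 <= t by rewrite subr_ge0.
have tB : t <= 9 * v.
  apply: le_trans Bv; move/rtr_le: B2; rewrite opprB rtrB r1; exact.
have twp : psdmx (t%:C *: w) by exact: psdmxZ.
have h18 : 9 * v <= 18 * v by clear -v0; lra.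
exists t; split; [exact: t0 | exact: le_trans tB h18 | |].
  apply: densityE (psdmxD w0p twp) _.
  by rewrite rtrD rtrZ w1 mulr1 /t addrC subrK.
apply: (@le_trans _ _ (rtr (B + t%:C *: w))); last first.
  by rewrite rtrD rtrZ w1; clear -Bv tB; move: (rtr B) t Bv tB => b t' ? ?; lra.
apply: trace_norm_le.
- by rewrite adjmxB adjmxD (psdmx_adj w0p) (psdmx_adj twp) (psdmx_adj rp).
- by rewrite addrAC; exact: (lemxD B1 (lemxx _)).
- rewrite addrAC opprD; apply: (lemxD B2 _).
  exact: lemxN twp.
Qed.

End Projections.

(** * Typical projections *)

Section Stein.
Variable R : realType.
Local Notation C := R[i].

Lemma supp_le_mxfun d (rho sigma : 'M[C]_d) : density rho -> psdmx sigma ->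
  supp_le rho sigma -> rtr (rho *m mxfun (fun x => (x != 0)%:R) sigma) = 1.
Proof.
move=> dr sp /submxP[D rE]; have hs := psdmx_adj sp.
have sS : sigma *m mxfun (fun x : R => (x != 0)%:R) sigma = sigma.
  rewrite -{1}(mxfun_id hs); apply: etrans (mxfunM id _ hs) _.
  rewrite -[RHS](mxfun_id hs); congr (mxfun _ sigma); apply/funext => x /=.
  by case: eqP => [->|_]; rewrite ?mulr0 ?mulr1.
by rewrite -{2}(rtr_density dr) rE -mulmxA sS.
Qed.

Lemma gram_eq0 m n (X : 'M[C]_(m, n)) : rtr (X *m X^t*) = 0 -> X = 0.
Proof.
have Xp := psdmx_gramr X; rewrite /rtr => /(congr1 (fun x : R => x%:C)).
rewrite -(mxtrace_rtr Xp) rmorph0 => X0; apply/matrixP => i j; rewrite mxE.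
have pos k : true -> 0 <= (X *m X^t*) k k.
  by move=> _; rewrite mxE sumr_ge0 // => l _; rewrite !mxE mul_conjC_ge0.
have /(_ i isT) := psumr_eq0P pos X0; rewrite mxE => Xi0.
have pos' l : true -> 0 <= X i l * X^t* l i.
  by move=> _; rewrite !mxE mul_conjC_ge0.
have /(_ j isT) := psumr_eq0P pos' Xi0; rewrite !mxE => /eqP.
by rewrite mul_conjC_eq0 => /eqP.
Qed.

(** By contraposition: full weight on the support projection S of [sigma] makes (1 - S) W vanish for
    rho = W W^*, so rho = rho S, which factors through [sigma]. *)
Lemma not_supp_le_mxfun d (rho sigma : 'M[C]_d) : density rho -> psdmx sigma ->
  ~~ supp_le rho sigma -> rtr (rho *m mxfun (fun x => (x != 0)%:R) sigma) < 1.
Proof.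
move=> dr sp; rewrite ltNge; apply: contra => h.
have hs := psdmx_adj sp; have [rp _] := dr.
pose nz (x : R) : R := (x != 0)%:R.
have Sp : projmx (mxfun nz sigma) := mxfun_projmx _ hs.
have S'p := projmx_compl Sp.
have [W rE] := psdmx_adjoint_root rp.
have W0 : (1%:M - mxfun nz sigma) *m W = 0.
  apply: gram_eq0; rewrite (rtr_compress W (proj1 S'p) (proj2 S'p)) -rE.
  apply/eqP; rewrite eq_le (rtr_mul_ge0 rp (projmx_psd S'p)) andbT.
  by rewrite mulmxBr mulmx1 rtrB rtr_density // subr_le0.
have Sr : rho *m mxfun nz sigma = rho.
  have : (1%:M - mxfun nz sigma) *m rho = 0 by rewrite rE mulmxA W0 mul0mx.
  rewrite mulmxBl mul1mx => /eqP; rewrite subr_eq0 => /eqP rS.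
  have := congr1 (fun X : 'M[C]_d => X^t*) rS.
  by rewrite adjmxM (psdmx_adj rp) (proj1 Sp).
(* Since 0^-1 = 0 by convention, [mxfun] of the inverse is the pseudo-inverse of [sigma]. *)
have SE : mxfun (fun x => x^-1) sigma *m sigma = mxfun nz sigma.
  rewrite (mxfun_mulr _ hs); congr (mxfun _ sigma); apply/funext => x /=.
  rewrite /nz; case: eqP => [->|/eqP x0]; first by rewrite mulr0.
  by rewrite mulVf.
apply/submxP; exists (rho *m mxfun (fun x => x^-1) sigma).
by rewrite -mulmxA SE Sr.
Qed.

Lemma powR_gt0E (x s : R) : 0 < x -> x `^ s = expR (s * ln x).
Proof. by move=> x0; rewrite /powR gt_eqF. Qed.

Lemma ratio_powR_ge1 (x y s : R) : 0 < x -> 0 < y -> 0 <= s * (ln x - ln y) ->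
  1 <= x `^ s / y `^ s.
Proof.
move=> x0 y0 h; rewrite !powR_gt0E // -expRN -expRD -expR0 ler_expR.
by rewrite -mulrBr.
Qed.

Lemma expRXn_gt0 (k : R) n : 0 < expR k ^+ n.
Proof. by rewrite exprn_gt0 // expR_gt0. Qed.

Lemma mxfun_compl (f : R -> R) d (A : 'M[C]_d) : A^t* = A ->
  1%:M - mxfun f A = mxfun (fun x => 1 - f x) A.
Proof. by move=> hA; rewrite -(mxfun_cst1 hA) (mxfunB _ f hA). Qed.

(** Produces the domination that [tail_bound] asks for: at x = 0 the kernel term already equals 1,
    and at a rejected x > 0 the power ratio is at least 1. *)
Lemma indicator_tail_le (b : bool) (x y s : R) : 0 <= x -> 0 < y ->
  (~~ b -> 0 < x -> 0 <= s * (ln x - ln y)) ->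
  1 - b%:R <= 1 - (x != 0)%:R + x `^ s / y `^ s.
Proof.
move=> x0 y0 h; have r0 : 0 <= x `^ s / y `^ s.
  by rewrite divr_ge0 // powR_ge0.
case: b h => /= h.
  by rewrite subrr addr_ge0 // subr_ge0; case: (x != 0).
rewrite subr0; case: (eqVneq x 0) => [_|xn] /=; first by rewrite subr0 lerDl.
rewrite subrr add0r; apply: ratio_powR_ge1 => //; last apply: h => //.
  by rewrite lt_def xn.
by rewrite lt_def xn.
Qed.

(** The threshold lies below the mean, so [s] is negative and x^s is large on the small eigenvalues,
    those being discarded. *)
Lemma lower_typical d (rho B : 'M[C]_d) (k : R) : density rho -> psdmx B ->
  rtr (rho *m mxfun (fun x => (x != 0)%:R) B) = 1 ->
  k < rtr (rho *m mxfun (@ln R) B) ->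
  exists r, 0 <= r < 1 /\ forall n, rtr (ntensmx rho n *m
    (1%:M - mxfun (fun x => (expR k ^+ n <= x)%R%:R) (ntensmx B n))) <= r ^+ n.
Proof.
move=> dr Bp sB kB; have ek := expR_gt0 k.
have [|s [r [sm r1 rn]]] := tail_bound dr Bp sB ek; first by rewrite expRK gt_eqF.
exists r; split => // n; have Bnp := ntensmx_psd n Bp.
rewrite (mxfun_compl _ (psdmx_adj Bnp)); apply: rn => x x0.
apply: indicator_tail_le => //; first exact: expRXn_gt0.
rewrite -ltNge => xk xpos; rewrite mulr_le0 //.
  by move: sm; rewrite expRK pmulr_llt0 ?subr_gt0 // => /ltW.
by rewrite subr_le0 ler_ln ?posrE ?expRXn_gt0 // ltW.
Qed.

(** The mirror image, with [s] positive. *)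
Lemma upper_typical d (rho B : 'M[C]_d) (k : R) : density rho -> psdmx B ->
  rtr (rho *m mxfun (fun x => (x != 0)%:R) B) = 1 ->
  rtr (rho *m mxfun (@ln R) B) < k ->
  exists r, 0 <= r < 1 /\ forall n, rtr (ntensmx rho n *m
    (1%:M - mxfun (fun x => (x <= expR k ^+ n)%R%:R) (ntensmx B n))) <= r ^+ n.
Proof.
move=> dr Bp sB kB; have ek := expR_gt0 k.
have [|s [r [sm r1 rn]]] := tail_bound dr Bp sB ek; first by rewrite expRK lt_eqF.
exists r; split => // n; have Bnp := ntensmx_psd n Bp.
rewrite (mxfun_compl _ (psdmx_adj Bnp)); apply: rn => x x0.
apply: indicator_tail_le => //; first exact: expRXn_gt0.
rewrite -ltNge => xk xpos; rewrite mulr_ge0 //.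
  by move: sm; rewrite expRK nmulr_llt0 ?subr_lt0 // => /ltW.
by rewrite subr_ge0 ler_ln ?posrE ?expRXn_gt0 // ltW.
Qed.

End Stein.

(** * Tests and smoothed states *)

Section SteinTests.
Variable R : realType.
Local Notation C := R[i].

Lemma mxfun_le_scale (f : R -> R) c n (A : 'M[C]_n) : psdmx A ->
  (forall x, 0 <= x -> f x <= c * x) -> lemx (mxfun f A) (c%:C *: A).
Proof.
move=> Ap fc; have hA := psdmx_adj Ap; rewrite -{2}(mxfun_id hA) (mxfunZ c id hA).
exact: mxfun_le.
Qed.

Lemma mxfun_le_cst (f : R -> R) c n (A : 'M[C]_n) : psdmx A ->
  (forall x, 0 <= x -> f x <= c) -> lemx (mxfun f A) (c%:C *: 1%:M).
Proof.
move=> Ap fc; have hA := psdmx_adj Ap.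
rewrite -(mxfun_cst1 hA) (mxfunZ c (fun=> 1) hA).
by apply: mxfun_le => // x x0; rewrite mulr1 fc.
Qed.

Lemma mxfun_sandwich (f : R -> R) n (A : 'M[C]_n) : A^t* = A ->
  mxfun f A *m A *m mxfun f A = mxfun (fun x => f x * x * f x) A.
Proof.
move=> hA; rewrite (mxfun_mulr f hA).
exact: (mxfunM (fun x => f x * x) f hA).
Qed.

Lemma upper_sandwich (y : R) n (A : 'M[C]_n) : psdmx A -> 0 <= y ->
  lemx (mxfun (fun x => (x <= y)%R%:R) A *m A *m mxfun (fun x => (x <= y)%R%:R) A)
       (y%:C *: 1%:M).
Proof.
move=> Ap y0; rewrite (mxfun_sandwich _ (psdmx_adj Ap)).
apply: mxfun_le_cst => // x x0; case: (leP x y) => xy /=.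
  by rewrite mul1r mulr1.
by rewrite mulr0.
Qed.

Lemma lower_scale (y : R) n (A : 'M[C]_n) : psdmx A -> 0 < y ->
  lemx (mxfun (fun x => (y <= x)%R%:R) A) (y^-1%:C *: A).
Proof.
move=> Ap y0; apply: mxfun_le_scale => // x x0; rewrite mulrC.
case: (leP y x) => yx /=; last by rewrite divr_ge0 // ltW.
by rewrite ler_pdivlMr // mul1r.
Qed.

Lemma expr_le_max (x y : R) n : 0 <= x -> x ^+ n <= Num.max x y ^+ n.
Proof. by move=> x0; rewrite lerXn2r ?nnegrE ?le_max ?x0 ?lexx. Qed.

Definition relent_fin d (rho sigma : 'M[C]_d) : R :=
  rtr (rho *m mxfun (@ln R) rho) - rtr (rho *m mxfun (@ln R) sigma).

Lemma relentE d (rho sigma : 'M[C]_d) : relent rho sigma =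
  if supp_le rho sigma then (relent_fin rho sigma)%:E else +oo%E.
Proof. by rewrite /relent; case: ifP => // _; rewrite mulmxBr -/(rtr _) rtrB. Qed.

Lemma supp_lexx d (rho : 'M[C]_d) : supp_le rho rho.
Proof. exact: submx_refl. Qed.

Lemma expR_ratioXn (k l : R) n :
  expR l ^+ n * (expR k ^+ n)^-1 = expR (n%:R * (l - k)).
Proof. by rewrite -exprVn -expRN -exprMn -expRD expRM_natl. Qed.

(** Achievability in quantum Stein's lemma. P keeps eigenvalues of rho^n above e^(n(A-e)), so tr P
    is at most e^(-n(A-e)); Q keeps those of sigma^n below e^(n(m+e)), so Q sigma^n Q is at most
    that scalar. The product of the two bounds controls tr sigma^n QPQ. *)
Lemma stein_test d (rho sigma : 'M[C]_d) (a : R) :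
  density rho -> density sigma -> supp_le rho sigma ->
  a < relent_fin rho sigma ->
  exists q : R, 0 <= q < 1 /\ forall n, exists T : 'M[C]_(d ^ n),
    [/\ psdmx T, lemx T 1%:M,
        rtr (T *m ntensmx sigma n) <= expR (- (n%:R * a)) &
        1 - rtr (T *m ntensmx rho n) <= 5 * q ^+ n].
Proof.
move=> dr ds rs aD; have [rp _] := dr; have [sp _] := ds.
have nr := supp_le_mxfun dr rp (supp_lexx rho).
have ns := supp_le_mxfun dr sp rs.
have [A EA] : exists A, A = rtr (rho *m mxfun (@ln R) rho).
  exact: (ex_intro _ _ erefl).
have [m Em] : exists m, m = rtr (rho *m mxfun (@ln R) sigma).
  exact: (ex_intro _ _ erefl).
have {}aD : a < A - m by rewrite EA Em.
(* Half the gap, since both thresholds are moved by [e]. *)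
pose e := (A - m - a) / 2.
have e0 : 0 < e by rewrite divr_gt0 // subr_gt0.
have kE : m + e - (A - e) = - a by rewrite /e; clear; field.
have [|r1 [/andP[r10 r11] Pn]] := lower_typical (k := A - e) dr rp nr.
  by rewrite -EA ltrBlDr ltrDl.
have [|r2 [/andP[r20 r21] Qn]] := upper_typical (k := m + e) dr sp ns.
  by rewrite -Em ltrDl.
exists (Num.max r1 r2); split; first by rewrite le_max r10 gt_max r11 r21.
move=> n; have rnp := ntensmx_psd n rp; have snp := ntensmx_psd n sp.
have rnd := ntensmx_density n dr.
have y1 := expRXn_gt0 (A - e) n; have y2 := expRXn_gt0 (m + e) n.
have PB := lower_scale rnp y1; have QB := upper_sandwich snp (ltW y2).
have Pp : projmx (mxfun (fun x => (expR (A - e) ^+ n <= x)%R%:R) (ntensmx rho n)).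
  exact: mxfun_projmx (psdmx_adj rnp).
have Qp : projmx (mxfun (fun x => (x <= expR (m + e) ^+ n)%R%:R) (ntensmx sigma n)).
  exact: mxfun_projmx (psdmx_adj snp).
move: {Pn} (Pn n) {Qn} (Qn n) PB QB Pp Qp.
move: (mxfun (fun x => _) (ntensmx rho n)) => P.
move: (mxfun (fun x => _) (ntensmx sigma n)) => Q Pn Qn PB QB Pp Qp.
have [hQ QQ] := Qp; have Ppsd := projmx_psd Pp; have Qpsd := projmx_psd Qp.
exists (Q *m P *m Q); split.
- by have := psdmx_conj Q Ppsd; rewrite hQ.
- have := lemx_conj Q (projmx_le1 Pp); rewrite hQ mulmx1 QQ => h.
  exact: lemx_trans h (projmx_le1 Qp).
- have -> : rtr (Q *m P *m Q *m ntensmx sigma n) =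
            rtr (P *m (Q *m ntensmx sigma n *m Q)).
    by rewrite -!mulmxA rtr_mulC -!mulmxA.
  apply: le_trans (rtr_mul_le Ppsd QB) _.
  rewrite -scalemxAr rtrZ mulmx1.
  have := rtr_le PB; rewrite rtrZ (rtr_density rnd) mulr1 => h.
  have -> : - (n%:R * a) = n%:R * (m + e - (A - e)) by rewrite kE mulrN.
  by rewrite -expR_ratioXn ler_wpM2l // ltW.
(* Both errors are at most q^n, and 5 = 2 + 3. *)
- have := test_error rnp Pp Qp; rewrite mulmxBr mulmx1 rtrB (rtr_density rnd).
  rewrite (rtr_mulC (Q *m P *m Q)) => /le_trans; apply.
  have h1 := le_trans Pn (expr_le_max r2 n r10).
  have := expr_le_max r1 n r20; rewrite maxC => h2'.
  have h2 := le_trans Qn h2'; move: (rtr _) (rtr _) (_ ^+ n) h1 h2 => x y z h1 h2.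
  by clear -h1 h2; lra.
Qed.

(** A bound on the smoothed max-relative entropy. P rho^n P is at most e^(n(A+e)) and Q is at most
    e^(-n(m-e)) sigma^n, so QP rho^n PQ is at most e^(na) sigma^n. The lost trace is refilled with
    sigma^n itself, which adds the term 18 q^n. *)
Lemma smooth_dmax d (rho sigma : 'M[C]_d) (a : R) :
  density rho -> density sigma -> supp_le rho sigma ->
  relent_fin rho sigma < a ->
  exists q : R, 0 <= q < 1 /\ forall n, exists w : 'M[C]_(d ^ n),
    [/\ density w, trace_norm (w - ntensmx rho n) <= 18 * q ^+ n &
        lemx w ((expR (n%:R * a) + 18 * q ^+ n)%:C *: ntensmx sigma n)].
Proof.
move=> dr ds rs aD; have [rp _] := dr; have [sp _] := ds.
have nr := supp_le_mxfun dr rp (supp_lexx rho).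
have ns := supp_le_mxfun dr sp rs.
have [A EA] : exists A, A = rtr (rho *m mxfun (@ln R) rho).
  exact: (ex_intro _ _ erefl).
have [m Em] : exists m, m = rtr (rho *m mxfun (@ln R) sigma).
  exact: (ex_intro _ _ erefl).
have {}aD : A - m < a by rewrite EA Em.
pose e := (a - (A - m)) / 2.
have e0 : 0 < e by rewrite divr_gt0 // subr_gt0.
have kE : A + e - (m - e) = a by rewrite /e; clear; field.
have [|r1 [/andP[r10 r11] Pn]] := upper_typical (k := A + e) dr rp nr.
  by rewrite -EA ltrDl.
have [|r2 [/andP[r20 r21] Qn]] := lower_typical (k := m - e) dr sp ns.
  by rewrite -Em ltrBlDr ltrDl.
(* The value 1/2 keeps [r] positive, and [q] is its root: [gentle_projection] takes v = q^n > 0 and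
   errors up to v^2. *)
pose r := Num.max (Num.max r1 r2) 2^-1.
have r0 : 0 < r by rewrite lt_max invr_gt0 ltr0n orbT.
have r_1 : r < 1 by rewrite !gt_max r11 r21 invf_lt1 ?ltr1n // ltr0n.
pose q := Num.sqrt r; have q0 : 0 < q by rewrite sqrtr_gt0.
have q1 : q < 1 by rewrite -sqrtr1 ltr_sqrt.
have qr : q ^+ 2 = r by rewrite sqr_sqrtr // ltW.
exists q; split; first by rewrite (ltW q0).
move=> n; have rnp := ntensmx_psd n rp; have snp := ntensmx_psd n sp.
have rnd := ntensmx_density n dr; have snd := ntensmx_density n ds.
have y1 := expRXn_gt0 (A + e) n; have y2 := expRXn_gt0 (m - e) n.
have QB := lower_scale snp y2; have PB := upper_sandwich rnp (ltW y1).
have Pp : projmx (mxfun (fun x => (x <= expR (A + e) ^+ n)%R%:R) (ntensmx rho n)).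
  exact: mxfun_projmx (psdmx_adj rnp).
have Qp : projmx (mxfun (fun x => (expR (m - e) ^+ n <= x)%R%:R) (ntensmx sigma n)).
  exact: mxfun_projmx (psdmx_adj snp).
have rq x : 0 <= x -> x <= r -> x ^+ n <= (q ^+ n) ^+ 2.
  by move=> x0 xr; rewrite exprAC qr lerXn2r ?nnegrE // ltW.
have Pv := le_trans (Pn n) (rq r1 r10 _); have Qv := le_trans (Qn n) (rq r2 r20 _).
rewrite /r !le_max !lexx !orbT /= in Pv Qv; move: {Pv Qv} (Pv isT) (Qv isT).
move: {Pn Qn} PB QB Pp Qp.
move: (mxfun (fun x => _) (ntensmx rho n)) => P.
move: (mxfun (fun x => _) (ntensmx sigma n)) => Q PB QB Pp Qp Pn Qn.
have [hQ QQ] := Qp.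
have v0 : 0 < q ^+ n by rewrite exprn_gt0.
have v1 : q ^+ n <= 1 by rewrite exprn_ile1 // ltW.
have [t [t0 tv dw nw]] := gentle_projection rnd Pp Qp snd v0 v1 Pn Qn.
exists (Q *m (P *m ntensmx rho n *m P) *m Q + t%:C *: ntensmx sigma n).
split; [exact: dw | exact: nw |].
rewrite rmorphD scalerDl; apply: lemxD; last first.
  rewrite /lemx -scalerBl -rmorphB; apply: psdmxZ => //.
  by rewrite subr_ge0.
have := lemx_conj Q PB; rewrite hQ -scalemxAr mulmx1 -scalemxAl QQ => h.
apply: lemx_trans h _; have := lemxZ (ltW y1) QB.
by rewrite scalerA -rmorphM expR_ratioXn kE.
Qed.

Lemma geometric_cvg0 (q : R) : 0 <= q < 1 -> (fun n => q ^+ n) @ \oo --> (0 : R).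
Proof. by move=> /andP[q0 q1]; apply: cvg_expr; rewrite ger0_norm. Qed.

(** Klein's inequality from smoothing: with D < a < 0, taking traces in [smooth_dmax] gives 1 <=
    e^(na) + 18 q^n, whose right-hand side tends to 0. *)
Lemma relent_fin_ge0 d (rho sigma : 'M[C]_d) :
  density rho -> density sigma -> supp_le rho sigma -> 0 <= relent_fin rho sigma.
Proof.
move=> dr ds rs; rewrite leNgt; apply/negP => D0.
pose a := relent_fin rho sigma / 2.
have Da : relent_fin rho sigma < a by rewrite /a; move: D0; clear; lra.
have a0 : a < 0 by rewrite /a; move: D0; clear; lra.
have [q [q01 wn]] := smooth_dmax dr ds rs Da.
have bound n : 1 <= expR a ^+ n + 18 * q ^+ n.
  have [w [dw _ /rtr_le]] := wn n.
  rewrite rtrZ (rtr_density dw) (rtr_density (ntensmx_density n ds)) mulr1.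
  by rewrite expRM_natl.
have cv : (fun n => expR a ^+ n + 18 * q ^+ n) @ \oo --> (0 + 18 * 0 : R).
  apply: cvgD; first by apply: geometric_cvg0; rewrite expR_ge0 expR_lt1.
  by apply: cvgMr; exact: geometric_cvg0.
have : 1 <= lim ((fun n => expR a ^+ n + 18 * q ^+ n) @ \oo).
  by apply: limr_ge; [exact: cvgP cv | exact: nearW].
by rewrite (cvg_lim _ cv) // mulr0 addr0 ler10.
Qed.

End SteinTests.

(** * Reference pairs *)

Section Reference.
Variable R : realType.
Local Notation C := R[i].

Lemma psdmx_delta n (i : 'I_n) : psdmx (delta_mx i i : 'M[C]_n).
Proof.
have := psdmx_gramr (delta_mx i i : 'M[C]_n).
suff -> : delta_mx i i *m (delta_mx i i : 'M[C]_n)^t* = delta_mx i i by [].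
have -> : (delta_mx i i : 'M[C]_n)^t* = delta_mx i i.
  by apply/matrixP => j k; rewrite !mxE andbC; case: (_ && _);
    rewrite ?rmorph1 ?rmorph0.
by rewrite mul_delta_mx.
Qed.

Lemma density_delta n (i : 'I_n) : density (delta_mx i i : 'M[C]_n).
Proof.
split; first exact: psdmx_delta.
rewrite /mxtrace (bigD1 i) //= mxE !eqxx big1 ?addr0 // => j /negPf ji.
by rewrite mxE ji.
Qed.

Lemma density_mix n (w0 w1 : 'M[C]_n) p : density w0 -> density w1 ->
  0 <= p <= 1 -> density (p%:C *: w0 + (1 - p)%:C *: w1).
Proof.
move=> d0 d1 /andP[p0 p1]; have [q0 _] := d0; have [q1 _] := d1.
have p1' : 0 <= 1 - p by rewrite subr_ge0.
apply: densityE (psdmxD (psdmxZ p0 q0) (psdmxZ p1' q1)) _.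
by rewrite rtrD !rtrZ (rtr_density d0) (rtr_density d1) !mulr1 addrC subrK.
Qed.

(** Supplies the state to prepare on the second outcome so that a channel preparing [w] with
    probability [q] outputs exactly [sigma]. *)
Lemma mixture_complement n (w sigma : 'M[C]_n) q : density w -> density sigma ->
  q < 1 -> lemx (q%:C *: w) sigma ->
  exists w1, density w1 /\ sigma = q%:C *: w + (1 - q)%:C *: w1.
Proof.
move=> dw ds q1 le; have q1' : 0 < 1 - q by rewrite subr_gt0.
exists ((1 - q)^-1%:C *: (sigma - q%:C *: w)); split.
  apply: densityE.
    by apply: psdmxZ; [rewrite invr_ge0 ltW | exact: le].
  by rewrite rtrZ rtrB rtrZ (rtr_density dw) (rtr_density ds) mulr1 mulVf // gt_eqF.
rewrite scalerA -rmorphM divff ?gt_eqF // rmorph1 scale1r addrC subrK //.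
Qed.

Lemma trace_norm_mix n (w0 w1 : 'M[C]_n) p : density w0 -> density w1 -> p <= 1 ->
  trace_norm (p%:C *: w0 + (1 - p)%:C *: w1 - w0) <= 2 * (1 - p).
Proof.
move=> d0 d1 p1; have [q0 _] := d0; have [q1 _] := d1.
have p1' : 0 <= 1 - p by rewrite subr_ge0.
have -> : p%:C *: w0 + (1 - p)%:C *: w1 - w0 =
    (1 - p)%:C *: w1 - (1 - p)%:C *: w0.
  rewrite addrAC addrC; congr (_ + _).
  by rewrite rmorphB rmorph1 scalerBl scale1r opprB.
have P0 := psdmxZ p1' q0; have P1 := psdmxZ p1' q1.
have -> : 2 * (1 - p) = rtr ((1 - p)%:C *: w1 + (1 - p)%:C *: w0).
  by rewrite rtrD !rtrZ (rtr_density d0) (rtr_density d1) !mulr1 mulr_natl mulr2n.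
apply: trace_norm_le.
- by rewrite adjmxB (psdmx_adj P0) (psdmx_adj P1).
- exact: (lemxD (lemxx _) (lemxN P0)).
- by rewrite opprD opprK; exact: (lemxD (lemxN P1) (lemxx _)).
Qed.

Definition pi0 : 'M[C]_2 := delta_mx 0 0.
Definition pi1 : 'M[C]_2 := delta_mx 1 1.
(* The pair (pi0, ref b) has relative entropy b, and its n-th tensor power is
   interconvertible with (pi0, ref (n b)). *)
Definition ref (b : R) : 'M[C]_2 :=
  (expR (- b))%:C *: pi0 + (1 - expR (- b))%:C *: pi1.

Lemma density_pi0 : density pi0. Proof. exact: density_delta. Qed.
Lemma density_pi1 : density pi1. Proof. exact: density_delta. Qed.

Lemma expRN_le1 b : 0 <= b -> expR (- b) <= 1 :> R.
Proof. by move=> b0; rewrite -expR0 ler_expR oppr_le0. Qed.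

Lemma density_ref b : 0 <= b -> density (ref b).
Proof.
move=> b0; apply: density_mix density_pi0 density_pi1 _.
by rewrite expR_ge0 expRN_le1.
Qed.

Lemma pi00 : pi0 *m pi0 = pi0. Proof. exact: mul_delta_mx. Qed.
Lemma pi01 : pi0 *m pi1 = 0. Proof. exact: mul_delta_mx_0. Qed.

Lemma pi0_ref b : pi0 *m ref b = (expR (- b))%:C *: pi0.
Proof.
by rewrite /ref mulmxDr -!scalemxAr pi00 pi01 scaler0 addr0.
Qed.

Lemma lemx_pi0_ref b : 0 <= b -> lemx ((expR (- b))%:C *: pi0) (ref b).
Proof.
move=> b0; rewrite /lemx /ref addrC addKr; apply: psdmxZ.
  by rewrite subr_ge0 expRN_le1.
exact: (proj1 density_pi1).
Qed.

Lemma lemx_pi0_ref_ntens b n : 0 <= b ->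
  lemx ((expR (- (n%:R * b)))%:C *: ntensmx pi0 n) (ntensmx (ref b) n).
Proof.
move=> b0; have [p0 _] := density_pi0.
have := ntensmx_le n (psdmxZ (expR_ge0 (- b)) p0) (lemx_pi0_ref b0).
by rewrite ntensmxZ -rmorphXn -expRM_natl mulrN.
Qed.

Lemma supp_le_pi0_ref b : supp_le pi0 (ref b).
Proof.
apply/submxP; exists ((expR b)%:C *: pi0).
by rewrite -scalemxAl pi0_ref scalerA -rmorphM -expRD subrr expR0 rmorph1 scale1r.
Qed.

(** Enclosing n b between consecutive integers bounds n times the error |f b - f 1 b| by f 1 for
    every n, so the error is 0. *)
Lemma additive_monotone_linear (f : R -> R) :
  (forall b, 0 < b -> 0 <= f b) ->
  (forall b b', 0 < b -> b <= b' -> f b <= f b') ->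
  (forall b n, 0 < b -> (0 < n)%N -> f (n%:R * b) = n%:R * f b) ->
  forall b, 0 < b -> f b = f 1 * b.
Proof.
move=> f0 fm fa b b0.
have f1 := f0 1 ltr01.
have archi x y : 0 <= y -> (forall n, (0 < n)%N -> n%:R * x <= y) -> x <= 0 :> R.
  move=> y0 H; rewrite leNgt; apply/negP => x0.
  have yx : 0 <= y / x by rewrite divr_ge0 // ltW.
  have := H (Num.trunc (y / x)).+1 isT; rewrite leNgt -ltr_pdivrMr //.
  by rewrite truncnS_gt.
have key n : (0 < n)%N -> n%:R * (f b - f 1 * b) <= f 1 /\
                         n%:R * (f 1 * b - f b) <= f 1.
  move=> n0; have nb0 : 0 < n%:R * b by rewrite mulr_gt0 // ltr0n.
  have /andP[m1 m2] := truncn_itv (ltW nb0); set m := Num.trunc _ in m1 m2.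
  have fn := fa b n b0 n0.
  have u1 : f (n%:R * b) <= m.+1%:R * f 1.
    by rewrite -fa // mulr1; apply: fm => //; exact: ltW.
  have u2 : m%:R * f 1 <= f (n%:R * b).
    (* Additivity speaks of positive multiples only; m = 0 is covered by nonnegativity. *)
    case: m m1 {m2 u1} => [|m] m1; first by rewrite mul0r f0.
    by rewrite -fa // mulr1; apply: fm => //; rewrite ltr0n.
  have v1 : m%:R * f 1 <= n%:R * b * f 1 by rewrite ler_wpM2r.
  have v2 : n%:R * b * f 1 <= m.+1%:R * f 1 by rewrite ler_wpM2r // ltW.
  rewrite fn in u1 u2; rewrite -[m.+1%:R]natr1 mulrDl mul1r in u1 v2.
  by split; clear -u1 u2 v1 v2; lra.
apply/eqP; rewrite eq_le -subr_le0 -[X in _ && X]subr_le0.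
by apply/andP; split; apply: archi f1 _ => n /key[].
Qed.

End Reference.

(** * Upper bounds from lower asymptotic continuity *)

Section LowerLimit.
Variable R : realType.
Local Notation C := R[i].
Local Open Scope ereal_scope.

Lemma limn_einf_le (u : (\bar R)^nat) l N :
  (forall n, (N <= n)%N -> u n <= l) -> limn_einf u <= l.
Proof.
move=> ul; apply: le_trans (limn_einf_sup u) _.
rewrite limn_esup_lim; apply: lime_le; first exact: is_cvg_esups.
exists N => // n /= Nn; apply: ge_ereal_sup => _ [k /= nk <-].
by apply: ul; exact: leq_trans nk.
Qed.

(** The form in which continuity is applied: states close to rho^n with divergence at most n x + K
    bound the rate of [rho] itself. A value above [x] would make the lower limit negative. *)
Lemma divergence_le_of_approx (DQ : divergence R) d (rho sigma : 'M[C]_d)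
    (x K c q : R) :
  weakly_additive DQ -> lower_asymptotically_continuous DQ ->
  (forall e (w s : 'M[C]_e), density w -> density s -> 0 <= DQ e w s) ->
  density rho -> density sigma -> (0 <= q < 1)%R ->
  (forall n, (0 < n)%N -> exists w : 'M[C]_(d ^ n),
    [/\ density w, (trace_norm (w - ntensmx rho n) <= c * q ^+ n)%R &
        DQ (d ^ n)%N w (ntensmx sigma n) <= (n%:R * x + K)%:E]) ->
  DQ d rho sigma <= x%:E.
Proof.
move=> DA DC D0 dr ds q01 H.
(* Continuity wants a state for every n, so n = 0 receives a dummy. *)
have H' n : exists w : 'M[C]_(d ^ n), density w /\ ((0 < n)%N ->
    (trace_norm (w - ntensmx rho n) <= c * q ^+ n)%R /\
    DQ (d ^ n)%N w (ntensmx sigma n) <= (n%:R * x + K)%:E).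
  case: n => [|n].
    by exists (ntensmx rho 0); split => //; exact: ntensmx_density.
  by have [w [dw nw Dw]] := H n.+1 isT; exists w.
pose w n := sval (cid (H' n)); have wP n := svalP (cid (H' n)).
have wd n : density (w n) by exact: (proj1 (wP n)).
have wn n : (0 < n)%N -> (trace_norm (w n - ntensmx rho n) <= c * q ^+ n)%R.
  by move=> n0; exact: (proj1 (proj2 (wP n) n0)).
have wD n : (0 < n)%N -> DQ (d ^ n)%N (w n) (ntensmx sigma n) <= (n%:R * x + K)%:E.
  by move=> n0; exact: (proj2 (proj2 (wP n) n0)).
have cv : (fun n => trace_norm (w n - ntensmx rho n)) @ \oo --> (0 : R)%R.
  apply: (@squeeze_cvgr _ _ _ _ (fun=> 0%R) (fun n => c * q ^+ n)%R).
  - by exists 1%N => // n /= n0; rewrite trace_norm_ge0 wn.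
  - exact: cvg_cst.
  - have -> : (0 = c * 0 :> R)%R by rewrite mulr0.
    by apply: cvgMr; exact: geometric_cvg0.
have L0 := DC d rho sigma w dr ds wd cv.
rewrite leNgt; apply/negP => xD; move: L0; apply/negP; rewrite -ltNge.
suff [l [N [l0 ul]]] : exists l N, (l < 0)%R /\ forall n, (N <= n)%N ->
    n%:R^-1%:E * (DQ (d ^ n)%N (w n) (ntensmx sigma n)
                 - DQ (d ^ n)%N (ntensmx rho n) (ntensmx sigma n))%dE <= l%:E.
  by apply: (le_lt_trans (limn_einf_le ul)); rewrite lte_fin.
have fin n : (0 < n)%N -> exists2 z : R, DQ (d ^ n)%N (w n) (ntensmx sigma n) = z%:E
    & (z <= n%:R * x + K)%R.
  move=> n0; have := wD n n0; have := D0 _ _ _ (wd n) (ntensmx_density n ds).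
  by case: (DQ _ _ _) => [z| |] //; exists z.
have := D0 _ _ _ dr ds; case Dy : (DQ d rho sigma) xD => [y| |] //= xy _.
  rewrite lte_fin in xy.
  (* From here on K/n is below half the gap y - x. *)
  pose N := (Num.trunc (2 * `|K| / (y - x))).+1.
  have yx : (0 < y - x)%R by rewrite subr_gt0.
  exists (- ((y - x) / 2))%R, N; split.
    by rewrite oppr_lt0 divr_gt0.
  move=> n Nn; have n0 : (0 < n)%N by exact: leq_trans Nn.
  have [z -> zle] := fin n n0; rewrite DA // Dy -EFinM.
  apply: (@le_trans _ _ (n%:R^-1%:E * (z - n%:R * y)%:E)); first exact: lexx.
  rewrite -EFinM lee_fin mulrC ler_pdivrMr ?ltr0n //.
  have KN : (2 * `|K| < n%:R * (y - x))%R.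
    rewrite -ltr_pdivrMr //; apply: lt_le_trans (truncnS_gt _) _.
    by rewrite ler_nat.
  have := ler_norm K; move: (n%:R : R) (`|K|%R) KN zle => m k KN zle Kk.
  by clear -KN zle Kk; lra.
(* Infinite divergence: a finite value minus +oo is -oo, so any negative bound works. *)
exists (-1)%R, 1%N; split; first by rewrite ltrN10.
move=> n n0; have [z -> zle] := fin n n0; rewrite DA // Dy.
rewrite gt0_muley ?lte_fin ?ltr0n //.
apply: (@le_trans _ _ (n%:R^-1%:E * -oo)); first exact: lexx.
by rewrite gt0_muleNy ?leNye // lte_fin invr_gt0 ltr0n.
Qed.

End LowerLimit.

(** * Monotone additive divergences *)

Section Characterization.
Variable R : realType.
Local Notation C := R[i].
Variable DQ : divergence R.
Arguments DQ : clear implicits.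
Hypothesis DQ_fin : finite_on_support DQ.
Hypothesis DQ_M : cptp_monotone DQ.
Hypothesis DQ_A : weakly_additive DQ.
Hypothesis DQ_C : lower_asymptotically_continuous DQ.
Local Open Scope ereal_scope.

(** Probabilities and outputs enter through equations, so that a desired target pair can be matched
    after rewriting. *)
Lemma DQ_measure d e (T rho sigma : 'M[C]_d) (w0 w1 w s : 'M[C]_e) p q :
  psdmx T -> lemx T 1%:M -> density rho -> density sigma ->
  density w0 -> density w1 -> rtr (T *m rho) = p -> rtr (T *m sigma) = q ->
  w = (p%:C *: w0 + (1 - p)%:C *: w1)%R ->
  s = (q%:C *: w0 + (1 - q)%:C *: w1)%R ->
  DQ e w s <= DQ d rho sigma.
Proof.
move=> Tp T1 dr ds d0 d1 <- <- -> ->.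
have := DQ_M (measure_prepare_cptp Tp T1 d0 d1) dr ds.
by rewrite /= (measure_prepareE w0 w1 Tp dr) (measure_prepareE w0 w1 Tp ds).
Qed.

(** The channel discards its input: with test 0 and [w] prepared on both outcomes, every state goes
    to [w]. *)
Lemma DQ_diag_le d e (rho sigma : 'M[C]_d) (w : 'M[C]_e) :
  density rho -> density sigma -> density w -> DQ e w w <= DQ d rho sigma.
Proof.
move=> dr ds dw; have T0 := psdmx0 R d.
have T1 : lemx (0 : 'M[C]_d) 1%:M by rewrite -psdmx_lemx; exact: psdmx1.
have mix p : w = (p%:C *: w + (1 - p)%:C *: w)%R.
  by rewrite -scalerDl -rmorphD addrC subrK rmorph1 scale1r.
exact: (DQ_measure T0 T1 dr ds dw dw erefl erefl (mix _) (mix _)).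
Qed.

(** Diagonal values are all minimal, hence equal for [w] and its square; additivity then gives 2z =
    z with z finite. *)
Lemma DQ_diag d (w : 'M[C]_d) : density w -> DQ d w w = 0.
Proof.
move=> dw; have dw2 := ntensmx_density 2 dw.
have /eqP : DQ (d ^ 2)%N (ntensmx w 2) (ntensmx w 2) = DQ d w w.
  by apply/eqP; rewrite eq_le !DQ_diag_le.
rewrite DQ_A //; have := DQ_fin dw dw (supp_lexx w).
case: (DQ d w w) => // z _; rewrite -EFinM => /eqP[] z2.
by congr (_%:E); lra.
Qed.

Lemma DQ_ge0 d (rho sigma : 'M[C]_d) :
  density rho -> density sigma -> 0 <= DQ d rho sigma.
Proof.
move=> dr ds; rewrite -(DQ_diag (density_pi0 R)).
by apply: DQ_diag_le (density_pi0 R).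
Qed.

Lemma lemx_pi0_1 : lemx (pi0 R) 1%:M.
Proof.
apply: projmx_le1; split; last exact: pi00.
exact: psdmx_adj (proj1 (density_pi0 R)).
Qed.

(** Max-relative entropy at most [b] lets the yardstick pair be mapped to the given one: outcome
    [pi0] prepares [w], the other outcome prepares the complement of [w] in [sigma]. *)
Lemma DQ_prepare (b : R) d (w sigma : 'M[C]_d) : (0 < b)%R ->
  density w -> density sigma -> lemx ((expR (- b))%:C *: w)%R sigma ->
  DQ d w sigma <= DQ 2%N (pi0 R) (ref b).
Proof.
move=> b0 dw ds le; have [p0 _] := density_pi0 R.
have b1 : (expR (- b) < 1)%R by rewrite expR_lt1 oppr_lt0.
have [w1 [dw1 sE]] := mixture_complement dw ds b1 le.
apply: (DQ_measure p0 lemx_pi0_1 (density_pi0 R) (density_ref (ltW b0))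
  dw dw1 _ _ _ sE).
- by rewrite pi00; exact: rtr_density (density_pi0 R).
- by rewrite pi0_ref rtrZ (rtr_density (density_pi0 R)) mulr1.
- by rewrite rmorph1 scale1r subrr rmorph0 scale0r addr0.
Qed.

(* Orthogonal pure states can be mapped to any pair of states. *)
Lemma DQ_le_orthogonal d (w sigma : 'M[C]_d) :
  density w -> density sigma -> DQ d w sigma <= DQ 2%N (pi0 R) (pi1 R).
Proof.
move=> dw ds; have [p0 _] := density_pi0 R.
apply: (DQ_measure p0 lemx_pi0_1 (density_pi0 R) (density_pi1 R) dw ds).
- by rewrite pi00; exact: rtr_density (density_pi0 R).
- by rewrite pi01 /rtr mxtrace0.
- by rewrite rmorph1 scale1r subrr rmorph0 scale0r addr0.
- by rewrite rmorph0 scale0r subr0 rmorph1 scale1r add0r.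
Qed.

(** One orthogonal pair can be mapped to two copies of itself, so 2z <= z. *)
Lemma DQ_orthogonal_fin : DQ 2%N (pi0 R) (pi1 R) \is a fin_num ->
  DQ 2%N (pi0 R) (pi1 R) = 0.
Proof.
have d0 := density_pi0 R; have d1 := density_pi1 R => Hfin.
have := DQ_le_orthogonal (ntensmx_density 2 d0) (ntensmx_density 2 d1).
rewrite DQ_A //; have := DQ_ge0 d0 d1; case: (DQ 2%N _ _) Hfin => // z _.
rewrite -EFinM !lee_fin => z0 z2; congr (_%:E).
by apply/eqP; rewrite eq_le z0 andbT; lra.
Qed.

Definition ref_value (b : R) : R := fine (DQ 2%N (pi0 R) (ref b)).

Lemma ref_valueE (b : R) : (0 <= b)%R -> DQ 2%N (pi0 R) (ref b) = (ref_value b)%:E.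
Proof.
move=> b0; rewrite fineK //; apply: DQ_fin (density_pi0 R) (density_ref b0) _.
exact: supp_le_pi0_ref.
Qed.

Lemma ref_value_ge0 (b : R) : (0 <= b)%R -> (0 <= ref_value b)%R.
Proof.
move=> b0; rewrite -lee_fin -ref_valueE //.
exact: DQ_ge0 (density_pi0 R) (density_ref b0).
Qed.

Lemma ref_value_linear (b : R) : (0 < b)%R -> ref_value b = (ref_value 1 * b)%R.
Proof.
have d0 := density_pi0 R; have [p0 _] := d0.
apply: additive_monotone_linear => {b}.
- by move=> b /ltW/ref_value_ge0.
- move=> b b' b0 bb'; rewrite -lee_fin -!ref_valueE ?(ltW b0) ?(le_trans (ltW b0)) //.
  have b'0 := lt_le_trans b0 bb'.
  apply: DQ_prepare b'0 d0 (density_ref (ltW b0)) _.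
  apply: lemx_trans (lemx_pi0_ref (ltW b0)).
  rewrite /lemx -scalerBl -rmorphB; apply: psdmxZ p0.
  by rewrite subr_ge0 ler_expR lerN2.
move=> b n b0 n0; have nb0 : (0 < n%:R * b)%R by rewrite mulr_gt0 // ltr0n.
have db := density_ref (ltW b0); have [bp _] := db.
have dnb := density_ref (ltW nb0).
have dn0 := ntensmx_density n d0; have dnr := ntensmx_density n db.
have [pn0 _] := dn0.
apply: EFin_inj; rewrite EFinM -!ref_valueE ?ltW // -DQ_A //.
apply/eqP; rewrite eq_le; apply/andP; split; last first.
  exact: DQ_prepare nb0 dn0 dnr (lemx_pi0_ref_ntens n (ltW b0)).
(* The other direction tests n copies with the power of [pi0], of probability 1 on the first state
   and e^(-nb) on the second, and so outputs the pair for n b. *)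
have T1 : lemx (ntensmx (pi0 R) n) 1%:M.
  apply: projmx_le1; split; first exact: psdmx_adj.
  by rewrite ntensmxM pi00.
apply: (DQ_measure (p := 1%R) pn0 T1 dn0 dnr d0 (density_pi1 R) _ _ _ erefl).
- rewrite rtr_ntens_mul // pi00 (rtr_density d0) expr1n //.
- rewrite rtr_ntens_mul // pi0_ref rtrZ (rtr_density d0) mulr1.
  by rewrite -expRM_natl mulrN.
- by rewrite rmorph1 scale1r subrr rmorph0 scale0r addr0.
Qed.

(** The Stein test maps n copies to exactly the n-th power of [ref a] and nearly that of [pi0]; the
    trace-norm error is twice the test error, whence 10 = 2 * 5. *)
Lemma DQ_ge_linear d (rho sigma : 'M[C]_d) (a y : R) :
  density rho -> density sigma -> supp_le rho sigma -> DQ d rho sigma = y%:E ->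
  (0 < a < relent_fin rho sigma)%R -> (ref_value 1 * a <= y)%R.
Proof.
move=> dr ds rs Dy /andP[a0 aD]; rewrite -ref_value_linear // -lee_fin.
have da := density_ref (ltW a0); have d0 := density_pi0 R; have [p0 _] := d0.
rewrite -(ref_valueE (ltW a0)).
have [q [q01 HT]] := stein_test dr ds rs aD.
apply: (divergence_le_of_approx (K := 0%R) (c := 10%R)
  DQ_A DQ_C DQ_ge0 d0 da q01) => n n0.
have [T [Tp T1 Tn Tr]] := HT n.
have dn0 := ntensmx_density n d0; have dna := ntensmx_density n da.
have dnr := ntensmx_density n dr; have dns := ntensmx_density n ds.
have [pn0 _] := dn0; have [rnp _] := dnr.
have t1 : (rtr (T *m ntensmx sigma n) < 1)%R.
  apply: le_lt_trans Tn _; rewrite expR_lt1 oppr_lt0 mulr_gt0 // ltr0n //.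
have le : lemx ((rtr (T *m ntensmx sigma n))%:C *: ntensmx (pi0 R) n)%R
    (ntensmx (ref a) n).
  apply: lemx_trans (lemx_pi0_ref_ntens n (ltW a0)).
  rewrite /lemx -scalerBl -rmorphB; apply: psdmxZ pn0.
  by rewrite subr_ge0.
have [w1 [dw1 sE]] := mixture_complement dn0 dna t1 le.
have p0' : (0 <= rtr (T *m ntensmx rho n))%R by exact: rtr_mul_ge0 Tp rnp.
have p1' : (rtr (T *m ntensmx rho n) <= 1)%R.
  by have := rtr_mul_le rnp T1; rewrite mulmx1 rtr_mulC (rtr_density dnr).
exists ((rtr (T *m ntensmx rho n))%:C *: ntensmx (pi0 R) n +
        (1 - rtr (T *m ntensmx rho n))%:C *: w1)%R; split.
- by apply: density_mix; rewrite ?p0' ?p1'.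
- apply: le_trans (trace_norm_mix dn0 dw1 p1') _.
  by move: (rtr _) (q ^+ n)%R Tr => u v Tr; lra.
- apply: le_trans (DQ_measure Tp T1 dnr dns dn0 dw1 erefl erefl erefl sE) _.
  by rewrite DQ_A // Dy addr0.
Qed.

Lemma DQ_le_linear d (rho sigma : 'M[C]_d) (a : R) :
  density rho -> density sigma -> supp_le rho sigma ->
  (relent_fin rho sigma < a)%R -> DQ d rho sigma <= (ref_value 1 * a)%:E.
Proof.
move=> dr ds rs Da; have a0 := le_lt_trans (relent_fin_ge0 dr ds rs) Da.
have [q [q01 Hw]] := smooth_dmax dr ds rs Da.
(* As a > 0, e^(na) + 18 q^n is at most 19 e^(na), so the yardstick parameter n a + ln 19 suffices
   and ln 19 vanishes in the rate. *)
apply: (divergence_le_of_approx (K := ref_value 1 * ln 19) (c := 18%R)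
  DQ_A DQ_C DQ_ge0 dr ds q01).
move=> n n0; have [w [dw wr wle]] := Hw n; exists w; split => //.
have dns := ntensmx_density n ds; have [snp _] := dns.
have l19 : (0 < ln 19 :> R)%R by rewrite ln_gt0 // ltr1n.
have b0 : (0 < n%:R * a + ln 19)%R by rewrite addr_gt0 // mulr_gt0 // ltr0n.
apply: le_trans (DQ_prepare b0 dw dns _) _; last first.
  by rewrite (ref_valueE (ltW b0)) lee_fin ref_value_linear // mulrDr mulrCA.
apply: lemx_trans (lemxZ (expR_ge0 _) wle) _.
rewrite scalerA -rmorphM /lemx -[X in (X - _)%R]scale1r.
rewrite -[1%R in X in psdmx X]/(1%:C)%R.
rewrite -scalerBl -rmorphB; apply: psdmxZ snp.
rewrite subr_ge0 expRN mulrC ler_pdivrMr ?expR_gt0 // mul1r expRD lnK ?posrE //.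
have e1 : (1 <= expR (n%:R * a))%R.
  by rewrite -expR0 ler_expR mulr_ge0 // ltW.
have q1 : (q ^+ n <= 1)%R.
  by case/andP: q01 => q0 /ltW q1; exact: exprn_ile1.
by move: (expR _) (q ^+ n)%R e1 q1 => u v e1 q1; lra.
Qed.

Lemma DQ_supp_le d (rho sigma : 'M[C]_d) :
  density rho -> density sigma -> supp_le rho sigma ->
  DQ d rho sigma = (ref_value 1 * relent_fin rho sigma)%:E.
Proof.
move=> dr ds rs; have := DQ_fin dr ds rs; case Dy: (DQ d rho sigma) => [y| |] // _.
have c0 := ref_value_ge0 ler01; set c := ref_value 1 in c0 *.
have y0 : (0 <= y)%R by rewrite -lee_fin -Dy DQ_ge0.
have D0 := relent_fin_ge0 dr ds rs; set D := relent_fin rho sigma in D0 *.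
congr (_%:E); apply/eqP; rewrite eq_le; apply/andP; split.
  (* Dividing by c + 1 also covers c = 0. *)
  apply/ler_addgt0Pr => e e0; have c1 : (0 < c + 1)%R by rewrite ltr_wpDl.
  have aD : (D < D + e / (c + 1))%R by rewrite ltrDl divr_gt0.
  have := DQ_le_linear dr ds rs aD; rewrite Dy lee_fin -/c => /le_trans; apply.
  rewrite mulrDr lerD2l mulrCA ger_pMr // ler_pdivrMr // mul1r lerDl.
  exact: ler01.
rewrite leNgt; apply/negP => ycD.
have cpos : (0 < c)%R.
  rewrite lt_def c0 andbT; apply: contraTneq ycD => ->; rewrite mul0r -leNgt //.
(* A midpoint strictly between y/c and D, positive because D is, contradicts [DQ_ge_linear]. *)
pose a := ((D + y / c) / 2)%R.
have yD : (y / c < D)%R by rewrite ltr_pdivrMr // mulrC.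
have yc0 : (0 <= y / c)%R by rewrite divr_ge0.
have aD : (0 < a < D)%R by rewrite /a; apply/andP; split; lra.
have := DQ_ge_linear dr ds rs Dy aD; rewrite -/c; apply/negP; rewrite -ltNge.
rewrite mulrC -ltr_pdivrMr //; rewrite /a; lra.
Qed.

(** A finite value here bounds the divergence of the orthogonal pair, which is then 0; as that pair
    dominates all others, every divergence vanishes. *)
Lemma DQ_not_supp_le d (rho sigma : 'M[C]_d) :
  density rho -> density sigma -> ~~ supp_le rho sigma ->
  DQ d rho sigma = +oo \/ DQ d rho sigma = 0 /\ ref_value 1 = 0%R.
Proof.
move=> dr ds rs; have := DQ_ge0 dr ds.
case Dy: (DQ d rho sigma) => [b| |] //; last first.
  by move=> _; left.
rewrite lee_fin => b0; right.
have [rp _] := dr; have [sp _] := ds.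
have d0 := density_pi0 R; have d1 := density_pi1 R.
have Sp := mxfun_projmx (fun x : R => x != 0%R) (psdmx_adj sp).
have s1 := not_supp_le_mxfun dr sp rs.
have sS := supp_le_mxfun ds sp (supp_lexx sigma).
move: (mxfun _ sigma) Sp s1 sS => S Sp s1 sS.
have Spsd := projmx_psd Sp.
have q01 : (0 <= rtr (rho *m S) < 1)%R by rewrite s1 andbT; exact: rtr_mul_ge0.
have Hb : DQ 2%N (pi0 R) (pi1 R) <= b%:E.
  apply: (divergence_le_of_approx (K := 0%R) (c := 2%R)
    DQ_A DQ_C DQ_ge0 d0 d1 q01) => n n0.
  have dn0 := ntensmx_density n d0; have dn1 := ntensmx_density n d1.
  have dnr := ntensmx_density n dr; have dns := ntensmx_density n ds.
  have Snp : projmx (ntensmx S n).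
    split; first by apply: psdmx_adj; exact: ntensmx_psd.
    by rewrite ntensmxM (proj2 Sp).
  (* This test fires when some copy lies in the kernel of [sigma]: never under sigma^n, and under
     rho^n it fails only with probability (tr rho S)^n. *)
  have Tp := projmx_compl Snp; have Tpsd := projmx_psd Tp.
  have tr (w : 'M[C]_d) : density w ->
      rtr ((1%:M - ntensmx S n)%R *m ntensmx w n) = (1 - rtr (w *m S) ^+ n)%R.
    move=> dw; have [wp _] := dw.
    rewrite mulmxBl mul1mx rtrB (rtr_density (ntensmx_density n dw)).
    by rewrite rtr_mulC rtr_ntens_mul.
  have := tr _ ds; rewrite sS expr1n subrr => ts.
  have qn : (0 <= 1 - rtr (rho *m S) ^+ n <= 1)%R.
    case/andP: q01 => q0 /ltW q1; apply/andP; split.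
      by rewrite subr_ge0 exprn_ile1.
    by rewrite lerBlDr lerDl exprn_ge0.
  exists ((1 - rtr (rho *m S) ^+ n)%:C *: ntensmx (pi0 R) n +
          (1 - (1 - rtr (rho *m S) ^+ n))%:C *: ntensmx (pi1 R) n)%R; split.
  - exact: density_mix dn0 dn1 qn.
  - case/andP: qn => _ qn1; apply: le_trans (trace_norm_mix dn0 dn1 qn1) _.
    by rewrite subKr.
  - apply: le_trans (DQ_measure Tpsd (projmx_le1 Tp) dnr dns dn0 dn1 (tr _ dr) ts
      erefl _) _.
      by rewrite rmorph0 scale0r subr0 rmorph1 scale1r add0r.
    by rewrite DQ_A // Dy addr0.
have H0 : DQ 2%N (pi0 R) (pi1 R) = 0.
  apply: DQ_orthogonal_fin; have := DQ_ge0 d0 d1.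
  by case: (DQ 2%N _ _) Hb.
split.
  have := DQ_le_orthogonal dr ds; rewrite H0 Dy lee_fin => b1.
  by congr (_%:E); apply/eqP; rewrite eq_le b1 b0.
have d1' := density_ref (@ler01 R).
have := DQ_le_orthogonal d0 d1'; rewrite H0 (ref_valueE ler01) lee_fin => c1.
by apply/eqP; rewrite eq_le c1 (ref_value_ge0 ler01).
Qed.

End Characterization.

Theorem theorem2p3 (R : realType) (DQ : divergence R)
  (DQ_fin : finite_on_support DQ)
  (DQ_M : cptp_monotone DQ)
  (DQ_A : weakly_additive DQ)
  (DQ_C : lower_asymptotically_continuous DQ) :
  exists c : R, forall (d : nat) (rho sigma : 'M[R[i]%C]_d),
    density rho -> density sigma ->
    const_multiple c (relent rho sigma) (DQ d rho sigma).
Proof.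
exists (ref_value DQ 1) => d rho sigma dr ds; rewrite relentE.
have c0 := ref_value_ge0 DQ_fin DQ_M DQ_A ler01.
case: ifP => [rs|/negbT rs].
  by left; rewrite (DQ_supp_le DQ_fin DQ_M DQ_A DQ_C dr ds rs).
have [->|[-> c_eq0]] := DQ_not_supp_le DQ_fin DQ_M DQ_A DQ_C dr ds rs.
  (* For c = 0 and an infinite divergence, the product 0 * +oo is read as +oo; in the last case
     below it is read as 0. *)
  have [c_eq0|c_neq0] := eqVneq (ref_value DQ 1) 0; first by right.
  by left; rewrite gt0_muley // lte_fin lt_def c_neq0.
by left; rewrite c_eq0 mul0e.
Qed.
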